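(* Let $n\in\mathbb{N}$ and $k\in\{1,\ldots,n\}$. If $E\subset\mathbb{H}^n$ is a $k$-regular set satisfying a corona decomposition by intrinsic Lipschitz graphs (ILG-C), then $E$ has big pieces of Lipschitz images of $\mathbb{R}^k$.
   Context: **Heisenberg group.** $\mathbb{H}^n$ is $\mathbb{R}^{2n}\times\mathbb{R}$ with product $(z,t)\cdot(z',t')=(z+z',t+t'+\omega(z,z'))$, where $\omega(z,z')=\frac12\sum_{i=1}^n(z_iz'_{n+i}-z_{n+i}z'_i)$. The Korányi norm is $\|(z,t)\|=\sqrt[4]{|z|^4+16t^2}$ and the Korányi distance is $d(x,y)=\|y^{-1}\cdot x\|$. $B(x,r)$ is the closed $d$-ball; $\mathrm{diam}$, $d(x,A)=\inf_{a\in A}d(x,a)$ and the Hausdorff measures $\mathcal{H}^s$ are taken with respect to $d$. $B^k(0,r)$ is the Euclidean ball in $\mathbb{R}^k$. $\mathcal{V}_k^0$ is the family of horizontal subgroups $V=V_I\times\{0\}$ with $V_I\subset\mathbb{R}^{2n}$ a $k$-dimensional isotropic linear subspace ($\omega(z,z')=0$ for all $z,z'\in V_I$). **Intrinsic Lipschitz graphs.** For $V=V_I\times\{0\}\in\mathcal{V}_k^0$ let $P_{V}(z,t)=(\pi_{V_I}(z),0)$, with $\pi_{V_I}$ the Euclidean orthogonal projection onto $V_I$, let $W=V_I^\perp\times\mathbb{R}$ and $P_W(y)=P_V(y)^{-1}\cdot y$. A map $\phi:V\to W$ with graph map $\Phi(v)=v\cdot\phi(v)$ is intrinsic Lipschitz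 if for some $L>0$, $\|P_W(\Phi(v')^{-1}\Phi(v))\|\le L\|P_V(\Phi(v')^{-1}\Phi(v))\|$ for all $v,v'\in V$; the best such $L$ is its intrinsic Lipschitz constant. A $k$-dimensional intrinsic Lipschitz graph is a set $\Phi(V)$ for some $V\in\mathcal{V}_k^0$ and intrinsic Lipschitz $\phi:V\to W$. **Regular sets.** $E\subset\mathbb{H}^n$ is $k$-regular if it is closed and there is $C_E>1$ with $C_E^{-1}r^k\le\mathcal{H}^k(E\cap B(x,r))\le C_Er^k$ for all $x\in E$, $0<r\le\mathrm{diam}(E)$, $r<\infty$. **Dyadic systems.** A dyadic system on a $k$-regular set $E$ is a collection $\mathcal{D}=\bigcup_{j\in\mathbb{J}}\mathcal{D}_j$, with each $\mathcal{D}_j$ a family of pairwise disjoint Borel sets, together with constants $\varrho\in(0,1)$, $D\in(1,\infty)$ (such systems exist with $\varrho,D$ depending only on $k$ and $C_E$) such that: (1) $E=\bigcup_{Q\in\mathcal{D}_j}Q$ for each $j\in\mathbb{J}$; (2) if $Q_1,Q_2\in\mathcal{D}$ intersect, one contains the other; (3) $D^{-1}\varrho^j\le\mathrm{diam}(Q)\le D\varrho^j$ and $D^{-1}\varrho^{jk}\le\mathcal{H}^k(Q)\le D\varrho^{jk}$ for $Q\in\mathcal{D}_j$; (4) for each $Q\in\mathcal{D}_j$ there is $x_Q\in E$ with $B(x_Q,D^{-1}\varrho^j)\cap E\subset Q$; (5) $\mathcal{H}^k(\{x\in Q:d(x,E\setminus Q)\le\eta\varrho^j\})\le D\eta^{1/D}\mathcal{H}^k(Q)$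 for all $Q\in\mathcal{D}_j$, $\eta>0$. Here $\mathbb{J}=\mathbb{Z}$ if $E$ is unbounded, and $\mathbb{J}=\{j\in\mathbb{Z}:j\ge J_0\}$ with $\varrho^{J_0+1}\le\mathrm{diam}(E)<\varrho^{J_0}$ otherwise. The children of $Q\in\mathcal{D}_j$ are the $R\in\mathcal{D}_{j+1}$ with $R\subset Q$. The set $E$ is considered with a fixed dyadic system $\mathcal{D}$. **Coronization with constant $C>0$.** A decomposition $\mathcal{D}=\mathcal{G}\,\dot\cup\,\mathcal{B}$ such that $\sum_{Q\in\mathcal{B},Q\subseteq R}\mathcal{H}^k(Q)\le C\mathcal{H}^k(R)$ for all $R\in\mathcal{D}$, and $\mathcal{G}$ can be partitioned into a family $\mathcal{F}$ of disjoint trees $\mathcal{S}$ such that: (a) each $\mathcal{S}\in\mathcal{F}$ is coherent, i.e. it has a unique maximal element $Q(\mathcal{S})$ containing all other elements of $\mathcal{S}$; if $Q\in\mathcal{S}$, $Q'\in\mathcal{D}$, $Q\subseteq Q'\subseteq Q(\mathcal{S})$ then $Q'\in\mathcal{S}$; and if $Q\in\mathcal{S}$ then either all or none of the children of $Q$ lie in $\mathcal{S}$; (b) $\sum_{\mathcal{S}\in\mathcal{F},Q(\mathcal{S})\subseteq R}\mathcal{H}^k(Q(\mathcal{S}))\le C\mathcal{H}^k(R)$ for all $R\in\mathcal{D}$. **(ILG-C).** For every $\eta>0$ there is $C=C(\eta)>0$ such that $E$ admits a coronization with constant $C$ in which for each $\mathcal{S}\in\mathcal{F}$ there is a $k$-dimensional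 intrinsic Lipschitz graph $\Gamma_{\mathcal{S}}$ with intrinsic Lipschitz constant at most $\eta$ such that for all $Q\in\mathcal{S}$: $d(x,\Gamma_{\mathcal{S}})\le\eta\,\mathrm{diam}(Q)$ whenever $x\in E$ and $d(x,Q)\le\mathrm{diam}(Q)$. **BPLI.** A $k$-regular set $E\subset\mathbb{H}^n$ has big pieces of Lipschitz images of $\mathbb{R}^k$ (equivalently, of subsets of $\mathbb{R}^k$, since for $k\le n$ Lipschitz maps from subsets of $\mathbb{R}^k$ to $\mathbb{H}^n$ extend to $\mathbb{R}^k$ with controlled constant) if there are constants $c,L>0$ such that for every $x\in E$ and $0<r<\mathrm{diam}(E)$ there exist $A\subset B^k(0,r)$ and an $L$-Lipschitz map $f:A\to(\mathbb{H}^n,d)$ with $\mathcal{H}^k(E\cap B(x,r)\cap f(A))\ge cr^k$. *)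

(* Defs.v *)
From HB Require Import structures.
From mathcomp Require Import all_boot all_order all_algebra.
From mathcomp Require Import all_classical all_reals all_analysis.
From mathcomp Require Import ring lra.

Set Implicit Arguments.
Unset Strict Implicit.
Unset Printing Implicit Defensive.

Import Order.TTheory GRing.Theory Num.Theory.
Import numFieldNormedType.Exports.

Local Open Scope classical_set_scope.
Local Open Scope ring_scope.

(* The library's norm on 'rV is the sup norm, so the Euclidean structure is
   set up here. *)
Section Euclidean.
Context {R : realType} {m : nat}.
Implicit Types u v w : 'rV[R]_m.

Definition dot u v : R := \sum_i u 0 i * v 0 i.

Definition enorm u : R := Num.sqrt (dot u u).

Lemma dotC u v : dot u v = dot v u.
Proof. by apply: eq_bigr => i _; rewrite mulrC. Qed.

Lemma dotDl u v w : dot (u + v) w = dot u w + dot v w.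
Proof. by rewrite -big_split; apply: eq_bigr => i _; rewrite mxE mulrDl. Qed.

Lemma dotZl a u v : dot (a *: u) v = a * dot u v.
Proof. by rewrite mulr_sumr; apply: eq_bigr => i _; rewrite mxE mulrA. Qed.

Lemma dotDr u v w : dot u (v + w) = dot u v + dot u w.
Proof. by rewrite dotC dotDl ![dot _ u]dotC. Qed.

Lemma dotZr a u v : dot u (a *: v) = a * dot u v.
Proof. by rewrite dotC dotZl dotC. Qed.

Lemma dot0l u : dot 0 u = 0.
Proof. by rewrite -(scale0r 0) dotZl mul0r. Qed.

Lemma dotNl u v : dot (- u) v = - dot u v.
Proof. by rewrite -scaleN1r dotZl mulN1r. Qed.

Lemma dotNr u v : dot u (- v) = - dot u v.
Proof. by rewrite dotC dotNl dotC. Qed.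

Lemma dot_ge0 u : 0 <= dot u u.
Proof. by apply: sumr_ge0 => i _; rewrite -expr2 sqr_ge0. Qed.

Lemma dot_eq0 u : dot u u = 0 -> u = 0.
Proof.
move=> /eqP; rewrite psumr_eq0 => [|i _]; last by rewrite -expr2 sqr_ge0.
move=> /allP u0; apply/rowP => i; rewrite mxE; apply/eqP.
by have := u0 i; rewrite mem_index_enum mulf_eq0 orbb => /(_ isT).
Qed.

Lemma dotE u v : dot u v = (u *m v^T) 0 0.
Proof. by rewrite mxE; apply: eq_bigr => i _; rewrite mxE. Qed.

Definition is_oproj (V : {vspace 'rV[R]_m}) u p : Prop :=
  p \in V /\ forall v, v \in V -> dot (u - p) v = 0.

Definition oproj (V : {vspace 'rV[R]_m}) u : 'rV[R]_m :=
  xget 0 [set p | is_oproj V u p].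

Lemma oprojP (V : {vspace 'rV[R]_m}) u : is_oproj V u (oproj V u).
Proof.
suff [p pP] : exists p, is_oproj V u p.
  by rewrite /oproj; case: xgetP => [? _|/(_ p)].
pose d := \dim V; pose B : 'M[R]_(d, m) := \matrix_i (vbasis V)`_i.
have BE (x : 'rV[R]_d) : x *m B = \sum_i x 0 i *: (vbasis V)`_i.
  by rewrite mulmx_sum_row; apply: eq_bigr => i _; rewrite rowK.
have BV (x : 'rV[R]_d) : x *m B \in V.
  rewrite BE memv_suml// => i _; rewrite memvZ// vbasis_mem// mem_nth//.
  by rewrite size_tuple.
have VB v : v \in V -> exists x : 'rV[R]_d, v = x *m B.
  move=> /coord_vbasis {1}->; exists (\row_i coord (vbasis V) i v).
  by rewrite BE; apply: eq_bigr => i _; rewrite mxE.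
have Binj (x : 'rV[R]_d) : x *m B = 0 -> x = 0.
  rewrite BE => x0; apply/rowP => i; rewrite mxE.
  by have /freeP /(_ (x 0) x0 i) := basis_free (vbasisP V).
have Mu : B *m B^T \in unitmx.
  rewrite -row_free_unit -kermx_eq0; apply/eqP/row_matrixP => i.
  rewrite row0; apply: Binj; apply: dot_eq0.
  rewrite dotE trmx_mul mulmxA -[_ *m B *m _]mulmxA.
  have /sub_kermxP -> : (row i (kermx (B *m B^T)) <= kermx (B *m B^T))%MS.
    exact: row_sub.
  by rewrite mul0mx mxE.
exists (u *m B^T *m invmx (B *m B^T) *m B); split; first exact: BV.
move=> v /VB[x ->]; rewrite dotE trmx_mul mulmxA mulmxBl.
by rewrite -[X in _ - X]mulmxA mulmxKV// subrr mul0mx mxE.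
Qed.

End Euclidean.

Definition heis (R : realType) (n : nat) : Type := ('rV[R]_(n + n) * R)%type.

Section Heisenberg.
Context {R : realType} {n : nat}.
Implicit Types (z w : 'rV[R]_(n + n)) (x y : heis R n).

Definition omega z w : R :=
  2^-1 * \sum_(i < n) (z 0 (lshift n i) * w 0 (rshift n i)
                       - z 0 (rshift n i) * w 0 (lshift n i)).

Definition heis_mul x y : heis R n := (x.1 + y.1, x.2 + y.2 + omega x.1 y.1).

Definition heis_one : heis R n := (0, 0).

Definition heis_inv x : heis R n := (- x.1, - x.2).

Definition knorm x : R :=
  Num.sqrt (Num.sqrt (enorm x.1 ^+ 4 + 16 * x.2 ^+ 2)).

Let symp w : 'rV[R]_(n + n) := row_mx (rsubmx w) (- lsubmx w).

Let omegaE z w : omega z w = 2^-1 * dot z (symp w).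
Proof.
rewrite /omega /dot big_split_ord/= -big_split; congr (_ * _).
by apply: eq_bigr => i _; rewrite row_mxEl row_mxEr !mxE mulrN.
Qed.

Let sympN w : symp (- w) = - symp w.
Proof. by rewrite /symp !linearN/= opp_row_mx. Qed.

Let sympD w z : symp (w + z) = symp w + symp z.
Proof. by rewrite /symp !linearD/= add_row_mx. Qed.

Let omegaDl z z' w : omega (z + z') w = omega z w + omega z' w.
Proof. by rewrite !omegaE dotDl mulrDr. Qed.

Let omegaDr z w w' : omega z (w + w') = omega z w + omega z w'.
Proof. by rewrite !omegaE sympD dotDr mulrDr. Qed.

Let omegaNl z w : omega (- z) w = - omega z w.
Proof. by rewrite !omegaE dotNl mulrN. Qed.

Let omegaNr z w : omega z (- w) = - omega z w.
Proof. by rewrite !omegaE sympN dotNr mulrN. Qed.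

Let omegazz z : omega z z = 0.
Proof.
by rewrite /omega big1 ?mulr0// => i _; rewrite [X in _ - X]mulrC subrr.
Qed.

Let omega0 z : omega 0 z = 0.
Proof. by rewrite omegaE dot0l mulr0. Qed.

Lemma heis_mulA : associative heis_mul.
Proof.
move=> x y z; rewrite /heis_mul/=; congr (_, _); first by rewrite addrA.
by rewrite omegaDl omegaDr; ring.
Qed.

Lemma heis_mul1x : left_id heis_one heis_mul.
Proof. by move=> [z t]; rewrite /heis_mul/= !add0r omega0 addr0. Qed.

Lemma heis_mulx1 : right_id heis_one heis_mul.
Proof.
move=> [z t]; rewrite /heis_mul/= !addr0 -[X in omega _ X](subrr z).
by rewrite omegaDr omegaNr subrr addr0.
Qed.

Lemma heis_mulVx : left_inverse heis_one heis_inv heis_mul.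
Proof.
by move=> [z t]; rewrite /heis_mul/= !addNr omegaNl omegazz oppr0 addr0.
Qed.

Lemma heis_mulxV : right_inverse heis_one heis_inv heis_mul.
Proof.
by move=> [z t]; rewrite /heis_mul/= !subrr omegaNr omegazz oppr0 addr0.
Qed.

HB.instance Definition _ := Choice.copy (heis R n) ('rV[R]_(n + n) * R)%type.

HB.instance Definition _ := isPointed.Build (heis R n) heis_one.

HB.instance Definition _ := @isGroup.Build (heis R n) heis_one heis_inv heis_mul
  heis_mulA heis_mul1x heis_mulx1 heis_mulVx heis_mulxV.

Let enorm4 z : enorm z ^+ 4 = dot z z ^+ 2.
Proof. by rewrite (exprM _ 2 2) sqr_sqrtr// dot_ge0. Qed.

Lemma knorm_ge0 x : 0 <= knorm x. Proof. exact: sqrtr_ge0. Qed.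

Lemma knorm4 x : knorm x ^+ 4 = dot x.1 x.1 ^+ 2 + 16 * x.2 ^+ 2.
Proof.
rewrite (exprM _ 2 2) /knorm enorm4 !sqr_sqrtr ?sqrtr_ge0//.
by rewrite addr_ge0 ?sqr_ge0// mulr_ge0 ?ler0n ?sqr_ge0.
Qed.

Lemma knormV x : knorm x^-1%g = knorm x.
Proof. by rewrite /knorm/= sqrrN /enorm dotNl dotNr opprK. Qed.

Lemma knorm_eq0 x : knorm x = 0 -> x = 1%g.
Proof.
move=> x0; have := knorm4 x; rewrite x0 expr0n/= => /esym/eqP.
have t0 : 0 <= 16 * x.2 ^+ 2 by rewrite mulr_ge0 ?ler0n ?sqr_ge0.
rewrite paddr_eq0 ?sqr_ge0// sqrf_eq0 mulf_eq0 sqrf_eq0 pnatr_eq0/=.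
by case: x {x0 t0} => z t /= /andP[/eqP/dot_eq0-> /eqP->].
Qed.

Lemma knorm1 : knorm 1%g = 0.
Proof.
rewrite /knorm /enorm /= dot0l sqrtr0.
by rewrite !expr0n/= mulr0 addr0 !sqrtr0.
Qed.

Let dot_omega z w : dot z w ^+ 2 + (2 * omega z w) ^+ 2 <= dot z z * dot w w.
Proof.
rewrite omegaE mulrA divff ?pnatr_eq0// mul1r.
have sw : dot (symp w) (symp w) = dot w w.
  rewrite /dot !big_split_ord/= addrC; congr (_ + _); apply: eq_bigr => i _.
    by rewrite row_mxEr !mxE mulrNN.
  by rewrite row_mxEl !mxE.
have w0 : dot w (symp w) = 0.
  have := omegazz w; rewrite omegaE => /eqP.
  by rewrite mulf_eq0 invr_eq0 pnatr_eq0 => /eqP.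
set a := dot z w; set b := dot z (symp w); set s := dot w w.
have := dot_ge0 (s *: z - a *: w - b *: symp w).
rewrite !(dotDl, dotDr, dotNl, dotNr, dotZl, dotZr) sw.
rewrite [dot w z]dotC [dot (symp w) z]dotC [dot (symp w) w]dotC w0.
rewrite -/a -/b -/s => H.
have : 0 <= s * (dot z z * s - (a ^+ 2 + b ^+ 2)) by move: H; nra.
have := dot_ge0 w; rewrite -/s le_eqVlt => /predU1P[s0 _|s0].
  have w00 := dot_eq0 (esym s0); have sw0 : symp w = 0.
    by apply: dot_eq0; rewrite sw -/s.
  by rewrite /a /b /s sw0 w00 ![dot z 0]dotC !dot0l mulr0 expr0n addr0.
by rewrite pmulr_rge0// subr_ge0.
Qed.

Let cs2 (a b c d p q : R) : 0 <= p -> 0 <= q ->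
  a ^+ 2 + b ^+ 2 <= p ^+ 2 -> c ^+ 2 + d ^+ 2 <= q ^+ 2 ->
  a * c + b * d <= p * q.
Proof.
move=> p0 q0 ab cd; apply: le_trans (ler_norm _) _.
rewrite -(@ler_pXn2r _ 2) ?nnegrE ?mulr_ge0// real_normK ?num_real// exprMn.
apply: (@le_trans _ _ ((a ^+ 2 + b ^+ 2) * (c ^+ 2 + d ^+ 2))); last first.
  by rewrite ler_pM// addr_ge0 ?sqr_ge0.
by have := sqr_ge0 (a * d - b * c); nra.
Qed.

Lemma knormM x y : knorm (x * y)%g <= knorm x + knorm y.
Proof.
have [x0 y0] := (knorm_ge0 x, knorm_ge0 y).
rewrite -(@ler_pXn2r _ 4) ?nnegrE ?addr_ge0 ?knorm_ge0// knorm4/=.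
have [x4 y4] := (knorm4 x, knorm4 y).
have := dot_omega x.1 y.1.
rewrite dotDl !dotDr [dot y.1 x.1]dotC.
have [q0 s0] := (dot_ge0 x.1, dot_ge0 y.1).
move: x0 y0 x4 y4 q0 s0.
set p := knorm x; set p' := knorm y; set q := dot x.1 x.1; set s := dot y.1 y.1.
set a := dot x.1 y.1; set b := omega x.1 y.1; set t := x.2; set t' := y.2.
move=> p0 p'0 p4 p'4 q0 s0 ab.
have P2 : q ^+ 2 + (4 * t) ^+ 2 <= (p ^+ 2) ^+ 2 by rewrite -exprM p4; lra.
have P'2 : s ^+ 2 + (4 * t') ^+ 2 <= (p' ^+ 2) ^+ 2 by rewrite -exprM p'4; lra.
have qp : q <= p ^+ 2.
  by rewrite -(@ler_pXn2r _ 2) ?nnegrE ?sqr_ge0//; have := sqr_ge0 (4 * t); lra.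
have sp : s <= p' ^+ 2.
  by rewrite -(@ler_pXn2r _ 2) ?nnegrE ?sqr_ge0//; have := sqr_ge0 (4 * t'); lra.
have AB : a ^+ 2 + (2 * b) ^+ 2 <= (p * p') ^+ 2.
  by rewrite (le_trans ab)// exprMn ler_pM.
have pp0 : 0 <= p * p' by rewrite mulr_ge0.
have h1 := cs2 (sqr_ge0 p) (sqr_ge0 p') P2 P'2.
have h2 := cs2 (sqr_ge0 p) pp0 P2 AB.
have h3 := cs2 (sqr_ge0 p') pp0 P'2 AB.
have -> : (p + p') ^+ 4 = (p ^+ 2) ^+ 2 + (p' ^+ 2) ^+ 2 + 4 * (p * p') ^+ 2
  + 2 * (p ^+ 2 * p' ^+ 2) + 4 * (p ^+ 2 * (p * p')) + 4 * (p' ^+ 2 * (p * p')).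
  by ring.
have -> : (q + a + (a + s)) ^+ 2 + 16 * (t + t' + b) ^+ 2 =
  (q ^+ 2 + (4 * t) ^+ 2) + (s ^+ 2 + (4 * t') ^+ 2)
  + 4 * (a ^+ 2 + (2 * b) ^+ 2)
  + 2 * (q * s + 4 * t * (4 * t')) + 4 * (q * a + 4 * t * (2 * b))
  + 4 * (s * a + 4 * t' * (2 * b)) by ring.
lra.
Qed.

Definition kdist x y : R := knorm (y^-1 * x)%g.

Lemma kdistxx x : kdist x x = 0.
Proof. by rewrite /kdist mulVg knorm1. Qed.

Lemma kdist_positivity x y : kdist x y = 0 -> x = y.
Proof. by move=> /knorm_eq0 xy; apply: (mulgI y^-1%g); rewrite xy mulVg. Qed.

Lemma kdist_sym x y : kdist x y = kdist y x.
Proof. by rewrite /kdist -knormV invgM invgK. Qed.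

Lemma kdist_triangle y x (z : heis R n) : kdist x z <= kdist x y + kdist y z.
Proof.
rewrite /kdist addrC (le_trans _ (knormM _ _))//.
by rewrite -mulgA (mulgA y) mulgV mul1g.
Qed.

(* [mdist] on [heis R n] is [kdist], and [open], [closed] and [ball] refer to
   the Koranyi distance. *)
HB.instance Definition _ := @isMetric.Build R (heis R n) kdist
  kdistxx kdist_positivity kdist_sym kdist_triangle.

Lemma mdist_heisE x y : mdist x y = knorm (y^-1 * x)%g.
Proof. by []. Qed.

End Heisenberg.

Section Metric.
Context {R : realType} {T : metricType R}.
Implicit Types (A : set T) (x : T).

Local Open Scope ereal_scope.

(* The library's [ball] is open; these are the closed balls. *)
Definition cball x (r : R) : set T := [set y | (mdist x y <= r)%R].

(* The maximum with 0 makes the diameter of the empty set 0. *)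
Definition diam A : \bar R :=
  maxe 0 (ereal_sup [set (mdist p.1 p.2)%:E | p in A `*` A]).

(* Equal to +oo when A is empty. *)
Definition setdist x A : \bar R := ereal_inf [set (mdist x a)%:E | a in A].

Definition hausdorff_content (k : nat) (delta : R) A : \bar R :=
  ereal_inf [set \sum_(0 <= i <oo) diam (U i) ^+ k | U in
    [set U : nat -> set T | A `<=` \bigcup_i U i /\
                            forall i, diam (U i) <= delta%:E]].

(* Only used for k > 0: for k = 0 the empty set would contribute 0 ^ 0 = 1. *)
Definition hausdorff (k : nat) A : \bar R :=
  ereal_sup [set hausdorff_content k delta A | delta in [set d : R | (0 < d)%R]].

Definition regular (k : nat) (E : set T) : Prop :=
  closed E /\
  exists C : R, (1 < C)%R /\
    forall x, E x -> forall r : R, (0 < r)%R -> r%:E <= diam E ->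
      (C^-1 * r ^+ k)%:E <= hausdorff k (E `&` cball x r) <= (C * r ^+ k)%:E.

(* The index set J of the generations; in the bounded case the least
   generation J0 is determined by the diameter. *)
Definition generations (E : set T) (rho : R) (J : set int) : Prop :=
  (diam E = +oo /\ J = setT) \/
  exists J0 : int,
    [/\ (rho ^ (J0 + 1))%:E <= diam E, diam E < (rho ^ J0)%:E &
        J = [set j | (J0 <= j)%R]].

(* [dy_level j] is the family D_j; its values outside [dy_gen] are
   irrelevant. *)
Record dyadic_system (k : nat) (E : set T) := DyadicSystem {
  dy_gen : set int;
  dy_level : int -> set (set T);
  dy_rho : R;
  dy_const : R;
  dy_rho_itv : (0 < dy_rho < 1)%R;
  dy_const_gt1 : (1 < dy_const)%R;
  dy_genP : generations E dy_rho dy_gen;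
  dy_disjoint : forall j, dy_gen j -> trivIset (dy_level j) id;
  dy_borel : forall j Q, dy_gen j -> dy_level j Q -> <<s open >> Q;
  dy_cover : forall j, dy_gen j -> E = \bigcup_(Q in dy_level j) Q;
  dy_nested : forall i j Q1 Q2, dy_gen i -> dy_gen j ->
    dy_level i Q1 -> dy_level j Q2 -> Q1 `&` Q2 !=set0 ->
    Q1 `<=` Q2 \/ Q2 `<=` Q1;
  dy_diam : forall j Q, dy_gen j -> dy_level j Q ->
    (dy_const^-1 * dy_rho ^ j)%:E <= diam Q <= (dy_const * dy_rho ^ j)%:E;
  dy_measure : forall j Q, dy_gen j -> dy_level j Q ->
    (dy_const^-1 * dy_rho ^ (j * k%:Z))%:E <= hausdorff k Q
      <= (dy_const * dy_rho ^ (j * k%:Z))%:E;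
  dy_center : forall j Q, dy_gen j -> dy_level j Q ->
    exists2 x, E x & cball x (dy_const^-1 * dy_rho ^ j) `&` E `<=` Q;
  dy_boundary : forall j Q (eta : R), dy_gen j -> dy_level j Q -> (0 < eta)%R ->
    hausdorff k [set x | Q x /\ setdist x (E `\` Q) <= (eta * dy_rho ^ j)%:E]
      <= (dy_const * eta `^ dy_const^-1)%:E * hausdorff k Q }.

Section Corona.
Context {k : nat} {E : set T} (D : dyadic_system k E).

Definition cubes : set (set T) :=
  [set Q | exists2 j, dy_gen D j & dy_level D j Q].

(* The children of Q as a member of generation j. The same set may be a member
   of several generations. *)
Definition children (j : int) (Q : set T) : set (set T) :=
  [set Q' | dy_level D (j + 1)%R Q' /\ Q' `<=` Q].

Definition is_tree_top (S : set (set T)) (Q : set T) : Prop :=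
  S Q /\ forall Q', S Q' -> Q' `<=` Q.

Definition tree_top (S : set (set T)) : set T :=
  xget set0 [set Q | is_tree_top S Q].

Definition coherent (S : set (set T)) : Prop :=
  [/\ exists! Q, is_tree_top S Q,
      forall Q Q', S Q -> cubes Q' -> Q `<=` Q' -> Q' `<=` tree_top S -> S Q' &
      forall j Q, dy_gen D j -> dy_level D j Q -> S Q ->
        children j Q `<=` S \/ children j Q `&` S = set0].

Definition coronization (C : R) (G B : set (set T)) (F : set (set (set T))) :
    Prop :=
  [/\ cubes = G `|` B /\ G `&` B = set0,
      forall Q0, cubes Q0 ->
        \esum_(Q in [set Q | B Q /\ Q `<=` Q0]) hausdorff k Q
          <= C%:E * hausdorff k Q0,
      G = \bigcup_(S in F) S /\ trivIset F id,
      forall S, F S -> coherent S &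
      forall Q0, cubes Q0 ->
        \esum_(S in [set S | F S /\ tree_top S `<=` Q0])
            hausdorff k (tree_top S)
          <= C%:E * hausdorff k Q0].

End Corona.

End Metric.

Section IntrinsicLipschitz.
Context {R : realType} {n : nat}.
Implicit Types (V : {vspace 'rV[R]_(n + n)}) (phi : heis R n -> heis R n).

Definition isotropic V : Prop :=
  forall z w, z \in V -> w \in V -> omega z w = 0.

(* The horizontal subgroup V_I x {0} is represented by the subspace V_I. *)
Definition hsub V : set (heis R n) := [set x | x.1 \in V /\ x.2 = 0].

Definition vsub V : set (heis R n) :=
  [set x | forall v, v \in V -> dot x.1 v = 0].

Definition hproj V (x : heis R n) : heis R n := (oproj V x.1, 0).

Definition vproj V (x : heis R n) : heis R n := ((hproj V x)^-1 * x)%g.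

Definition graph_map phi (v : heis R n) : heis R n := (v * phi v)%g.

(* phi is only relevant on hsub V. *)
Definition ilip_with V phi (L : R) : Prop :=
  forall v v', hsub V v -> hsub V v' ->
    let y := ((graph_map phi v')^-1 * graph_map phi v)%g in
    knorm (vproj V y) <= L * knorm (hproj V y).

Definition ilip V phi : Prop := exists2 L, 0 < L & ilip_with V phi L.

Definition ilip_const V phi : R := inf [set L | 0 < L /\ ilip_with V phi L].

Definition ilip_graph (k : nat) (eta : R) (Gamma : set (heis R n)) : Prop :=
  exists V phi,
    [/\ \dim V = k /\ isotropic V,
        forall v, hsub V v -> vsub V (phi v),
        ilip V phi, ilip_const V phi <= eta &
        Gamma = graph_map phi @` hsub V].

Local Open Scope ereal_scope.

Definition ILG_C (k : nat) (E : set (heis R n)) (D : dyadic_system k E) : Prop :=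
  forall eta : R, (0 < eta)%R ->
  exists C : R, (0 < C)%R /\
  exists G B F, coronization D C G B F /\
    forall S, F S ->
    exists Gamma, ilip_graph k eta Gamma /\
      forall Q, S Q -> forall x, E x -> setdist x Q <= diam Q ->
        setdist x Gamma <= eta%:E * diam Q.

Definition BPLI (k : nat) (E : set (heis R n)) : Prop :=
  exists c L : R, [/\ (0 < c)%R, (0 < L)%R &
    forall x, E x -> forall r : R, (0 < r)%R -> r%:E < diam E ->
    exists (A : set 'rV[R]_k) (f : 'rV[R]_k -> heis R n),
      [/\ forall a, A a -> (enorm a <= r)%R,
          forall a b, A a -> A b -> (mdist (f a) (f b) <= L * enorm (a - b))%R &
          (c * r ^+ k)%:E <= hausdorff k (E `&` cball x r `&` (f @` A))]].

End IntrinsicLipschitz.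

(* Main.v *)
Require Import Defs.
From HB Require Import structures.
From mathcomp Require Import all_boot all_order all_algebra finmap.
From mathcomp Require Import all_classical all_reals all_analysis.
From mathcomp Require Import ring lra zify.

(** A single small accuracy eta is used. On an intrinsic Lipschitz graph of constant
    less than 1 the horizontal projection h decreases distances by at most a factor 2,
    because the vertical part of the difference of two points of the graph is
    dominated by the horizontal part ([ilip_graph_projection]). Hence, for a cube Q of a tree, h satisfies
    d(x, y) <= 4 |h x - h y| for points of Q at a distance comparable to diam Q
    ([tree_chart]). The goal is a map g from a big piece of E to R^k with
    |g x - g y| >= c d(x, y); its inverse is the required Lipschitz map.

    Fix a cube R0 of diameter about r, and call special the cube R0 and, inside
    R0, the bad cubes and the tops of the trees. The two packing conditions bound the
    sum of the measures of the special cubes by (1 + 2C) times the measure of R0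
    ([special_packing]). Therefore, apart from a small part of R0, every point lies
    in a bounded number of special cubes ([deep_le]) and avoids a thin boundary layer
    of each of them ([layers_le]).

    Between a special cube Q which is not bad and the next special cube Q' around a
    point, all cubes belong to one tree, and h controls the distances. The difficulty lies in two maximal
    special subcubes Q1, Q2 of Q which are so close that eta diam Q1 exceeds their
    distance: the layers have to be thin in terms of the packing constant, which
    depends on eta, so they cannot prevent this. Such pairs are removed by the
    pigeonhole principle. The generations are coloured by residues, and at each
    scale the Heisenberg group is coloured by finitely many colours such that points
    of the same colour are very close or very far ([heis_colouring]). The colours of a
    point along its chain of special cubes form its code, there are finitely many
    codes, and one of them is shared by a definite part of R0
    ([exists_common_code]). Among points with the same code, points in different
    maximal subcubes are either far apart at the scale of these cubes, or the larger
    cube is so large that its layer separates them ([same_letter_separated]). In a bad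
    cube, all these points even lie in the same subcube.

    The map g is built by recursion on the code ([coded_expanding]): in a special cube
    with chart h, the maximal subcubes are sent to small copies of their own images,
    placed at the h-images of points of the subcubes. *)

Set Implicit Arguments.
Unset Strict Implicit.
Unset Printing Implicit Defensive.

Import Order.TTheory GRing.Theory Num.Theory.
Import numFieldNormedType.Exports.

Local Open Scope classical_set_scope.
Local Open Scope ring_scope.

(** * Hausdorff measure as an outer measure *)

(** A copy of T with a distinguished point, so that the sigma-algebra of all
    subsets of a nonempty metric space forms a measurable type. *)
Definition pointed_at (T : choiceType) (x0 : T) : Type := T.

HB.instance Definition _ (T : choiceType) (x0 : T) :=
  Choice.on (pointed_at x0).
HB.instance Definition _ (T : choiceType) (x0 : T) :=
  isPointed.Build (pointed_at x0) x0.

Section HausdorffOuter.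
Context {R : realType} {T : metricType R} (k : nat).
Implicit Types A B : set T.
Local Open Scope ereal_scope.

Lemma diam_ge0 A : 0 <= diam A.
Proof. by rewrite /diam le_max lexx. Qed.

Lemma diam_set0 : diam (set0 : set T) = 0.
Proof.
rewrite /diam (_ : [set _ | _ in _] = set0) ?ereal_sup0 ?max_l ?leNye//.
by apply/seteqP; split=> // x [p []].
Qed.

Lemma hausdorff_content_ge0 delta A : 0 <= hausdorff_content k delta A.
Proof.
apply: le_ereal_inf_tmp => _ [U _ <-].
by apply: nneseries_ge0 => i _ _; exact: expe_ge0 (diam_ge0 _).
Qed.

Lemma hausdorff_ge0 A : 0 <= hausdorff k A.
Proof.
apply: le_trans (hausdorff_content_ge0 1 A) _.
by apply: ereal_sup_ubound; exists 1%R => //=.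
Qed.

Lemma le_hausdorff A B : A `<=` B -> hausdorff k A <= hausdorff k B.
Proof.
move=> AB; apply: ge_ereal_sup => _ [d /= d0 <-].
apply: le_trans (_ : hausdorff_content k d B <= _).
  apply: ereal_inf_le_tmp => _ [U [BU Ud] <-]; exists U => //.
  by split=> //; exact: subset_trans BU.
by apply: ereal_sup_ubound; exists d.
Qed.

Hypothesis k_gt0 : (0 < k)%N.

Lemma hausdorff_set0 : hausdorff k (set0 : set T) = 0.
Proof.
apply/eqP; rewrite eq_le hausdorff_ge0 andbT.
apply: ge_ereal_sup => _ [d /= d0 <-]; apply: ge_ereal_inf.
exists 0 => //; exists (fun=> set0).
  by split=> // i; rewrite diam_set0 lee_fin ltW.
rewrite eseries0// => i _ _; rewrite diam_set0.
by case: k k_gt0 => // m _; rewrite expeS mul0e.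
Qed.

Section Gauge.
Variables (x0 : T) (delta : R).
Let X : measurableType _ := g_sigma_algebraType [set: set (pointed_at x0)].

(* The content is the outer measure generated by this set function: the
   infinite value takes sets of diameter exceeding delta out of play. *)
Let gauge (A : set X) : \bar R :=
  if diam (A : set T) <= delta%:E then diam (A : set T) ^+ k else +oo.

Let gauge_ge0 (A : set X) : 0 <= gauge A.
Proof. by rewrite /gauge; case: ifP => _ //; exact: expe_ge0 (diam_ge0 _). Qed.

Let contentE A : hausdorff_content k delta A = mu_ext gauge (A : set X).
Proof.
apply/eqP; rewrite eq_le; apply/andP; split.
  apply: le_ereal_inf_tmp => _ [F [mF AF] <-].
  have [Fd|/existsNP[i Fi]] := pselect (forall i, diam (F i : set T) <= delta%:E).
    apply: ereal_inf_lbound; exists F => //.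
    by apply: eq_eseriesr => i _; rewrite /gauge Fd.
  rewrite (@eseries_pinfty _ _ _ i) ?leey//.
    by move=> n _; rewrite -ltNye (lt_le_trans _ (gauge_ge0 _)).
  by rewrite /gauge; case: ifP.
apply: le_ereal_inf_tmp => _ [U [AU Ud] <-].
apply: ereal_inf_lbound; exists U.
  by split=> // i; exact: sub_sigma_algebra.
by apply: eq_eseriesr => i _; rewrite /gauge Ud.
Qed.

Lemma hausdorff_content_sigma_subadditive :
  sigma_subadditive (hausdorff_content k delta : set T -> \bar R).
Proof.
move=> A; rewrite contentE.
have := mu_ext_sigma_subadditive gauge_ge0 (A : nat -> set X).
move=> /le_trans; apply.
by apply: lee_nneseries => [i _ _|i _]; [exact: mu_ext_ge0|rewrite contentE].
Qed.

End Gauge.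

Lemma hausdorff_sigma_subadditive :
  sigma_subadditive (hausdorff k : set T -> \bar R).
Proof.
move=> A; have [->|/set0P[x0 _]] := eqVneq (\bigcup_n A n) set0.
  rewrite hausdorff_set0; apply: nneseries_ge0 => n _ _; exact: hausdorff_ge0.
apply: ge_ereal_sup => _ [d /= d0 <-].
apply: le_trans (hausdorff_content_sigma_subadditive x0 d A) _.
apply: lee_nneseries => [i _ _|i _]; first exact: hausdorff_content_ge0.
by apply: ereal_sup_ubound; exists d.
Qed.

End HausdorffOuter.

Section OuterCountable.
Local Open Scope ereal_scope.

(** For each n, only finitely many terms exceed 1 / (n + 1). *)
Lemma esum_fin_countable (R : realType) (I : choiceType) (J : set I)
    (a : I -> \bar R) :
  (forall i, J i -> 0 < a i) -> \esum_(i in J) a i < +oo -> countable J.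
Proof.
move=> a0 aoo.
have -> : J = \bigcup_n [set i | J i /\ n.+1%:R^-1%:E <= a i].
  apply/seteqP; split=> [i Ji|i [n _ []]//].
  have := a0 _ Ji; case ai : (a i) => [r| |]//; last first.
    by exists 0%N => //=; split=> //; rewrite ai leey.
  rewrite lte_fin => r0.
  exists (Num.truncn r^-1) => //=; split=> //; rewrite ai lee_fin.
  by rewrite -[leRHS]invrK lef_pV2 ?posrE ?invr_gt0// ltW// truncnS_gt.
apply: bigcup_countable => // n _; apply: finite_set_countable.
apply: contrapT => Jinf.
have : exists r : R, (0 <= r)%R /\ \esum_(i in J) a i = r%:E.
  have : 0 <= \esum_(i in J) a i by apply: esum_ge0 => i /a0/ltW.
  by case: (\esum_(i in J) a i) aoo => // r _; rewrite lee_fin => r0; exists r.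
move=> [r [r0 rE]].
have [X XJ Xn] := infinite_set_fset (Num.truncn (r * n.+1%:R)%R).+1 Jinf.
have : \sum_(i \in [set` X]) a i <= r%:E.
  rewrite -rE; apply: ereal_sup_ubound; exists [set` X] => //; split=> //.
  by move=> i /XJ[].
rewrite fsbig_finite//= set_fsetK leNgt => /negP; apply.
apply: (@lt_le_trans _ _ (\sum_(i <- X) n.+1%:R^-1%:E)).
  rewrite sumEFin lte_fin big_const_seq count_predT iter_addr_0.
  rewrite -[ltRHS]mulr_natr ltr_pdivlMl ?ltr0n// mulrC.
  by apply: lt_le_trans (truncnS_gt _) _; rewrite ler_nat.
rewrite big_seq [leRHS]big_seq; apply: lee_sum => i iX.
by have /= [] := XJ _ iX.
Qed.

Lemma subset_esum (R : realType) (I : choiceType) (A B : set I) (a : I -> \bar R) :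
  A `<=` B -> \esum_(i in A) a i <= \esum_(i in B) a i.
Proof.
move=> AB; apply: ereal_sup_le => _ [X [finX XA] <-]; exists X => //.
by split=> //; exact: subset_trans AB.
Qed.

Lemma le_esumU (R : realType) (I : choiceType) (A B : set I) (a : I -> \bar R) :
  (forall i, 0 <= a i) ->
  \esum_(i in A `|` B) a i <= \esum_(i in A) a i + \esum_(i in B) a i.
Proof.
move=> a0; rewrite esum_mkcond (esum_mkcond A) (esum_mkcond B) -esumD.
- apply: le_esum => i _; rewrite in_setU.
  by case: (i \in A); case: (i \in B) => //=; rewrite ?adde0 ?add0e ?leeDl.
- by move=> i _; case: ifP.
- by move=> i _; case: ifP.
Qed.

Lemma le_esumZ (R : realType) (I : choiceType) (A : set I) (a : I -> \bar R) (c : R) :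
  (0 <= c)%R -> (forall i, 0 <= a i) ->
  \esum_(i in A) (c%:E * a i) <= c%:E * \esum_(i in A) a i.
Proof.
move=> c0 a0; apply: ge_ereal_sup => _ [X [finX XA] <-].
rewrite -ge0_mule_fsumr// lee_wpmul2l ?lee_fin//.
by apply: ereal_sup_ubound; exists X.
Qed.

Section OuterMeasure.
Context {R : realType} {T : Type} (mu : {outer_measure set T -> \bar R}).

(** Countable subadditivity for families indexed by an arbitrary countable set,
    such as the special cubes below. *)
Lemma outer_measure_le_esum (I : choiceType) (J : set I) (A : I -> set T) :
  countable J -> mu (\bigcup_(i in J) A i) <= \esum_(i in J) mu (A i).
Proof.
elim/choicePpointed: I => I in J A *.
  by rewrite emptyE bigcup_set0 esum_set0 outer_measure0.
move=> /countable_bijP[B]; rewrite card_eq_sym => /card_set_bijP[f fbij].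
rewrite (reindex_esum _ _ _ _ fbij) esum_mkcond.
rewrite (_ : \bigcup_(i in J) A i =
             \bigcup_n (if n \in B then A (f n) else set0)).
  apply: le_trans (outer_measure_sigma_subadditive mu _) _.
  rewrite nneseries_esumT; last by move=> n; exact: outer_measure_ge0.
  by apply: le_esum => n _; case: ifP => _; rewrite ?outer_measure0.
have [fBJ _ fsurj] := fbij.
apply/seteqP; split=> [x [i Ji Aix]|x [n _]].
  by have [n Bn fn] := fsurj _ Ji; exists n => //; rewrite mem_set// fn.
by case: ifPn => [/set_mem Bn Ax|//]; exists (f n) => //; exact: fBJ.
Qed.

Lemma outer_measure_le_sum (I : choiceType) (s : seq I) (A : I -> set T) :
  mu (\bigcup_(i in [set` s]) A i) <= \sum_(i <- s) mu (A i).
Proof.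
rewrite bigcup_seq; elim: s => [|i s IH]; first by rewrite !big_nil outer_measure0.
rewrite !big_cons; apply: le_trans (outer_measureU2 mu _ _) _.
by rewrite leeD2l.
Qed.

End OuterMeasure.

End OuterCountable.

HB.instance Definition _ (R : realType) (T : metricType R) (k : nat) :=
  isOuterMeasure.Build R T (hausdorff k.+1)
    (hausdorff_set0 (ltn0Sn k)) (@hausdorff_ge0 R T k.+1)
    (@le_hausdorff R T k.+1)
    (hausdorff_sigma_subadditive (ltn0Sn k)).

(** * Euclidean geometry and projections of intrinsic graphs *)

Section EuclideanNorm.
Context {R : realType} {m : nat}.
Implicit Types u v w : 'rV[R]_m.

Lemma enorm_ge0 u : 0 <= enorm u.
Proof. exact: sqrtr_ge0. Qed.

Lemma sqr_enorm u : enorm u ^+ 2 = dot u u.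
Proof. by rewrite /enorm sqr_sqrtr// dot_ge0. Qed.

Lemma dot_le_enorm u v : dot u v <= enorm u * enorm v.
Proof.
have [u0 v0] := (enorm_ge0 u, enorm_ge0 v).
apply: le_trans (ler_norm _) _.
rewrite -(@ler_pXn2r _ 2) ?nnegrE ?mulr_ge0// real_normK ?num_real//.
rewrite exprMn !sqr_enorm.
have [->|vn0] := eqVneq v 0; first by rewrite !(dotC _ 0) !dot0l mulr0 expr0n.
have vv0 : 0 < dot v v.
  by rewrite lt_neqAle dot_ge0 andbT eq_sym; apply: contra vn0 => /eqP/dot_eq0->.
have := dot_ge0 (dot v v *: u - dot u v *: v).
rewrite !(dotDl, dotDr, dotNl, dotNr, dotZl, dotZr) [dot v u]dotC => H.
rewrite -subr_ge0 -(pmulr_rge0 _ vv0).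
by move: H; congr (_ <= _); ring.
Qed.

Lemma enormD u v : enorm (u + v) <= enorm u + enorm v.
Proof.
have [u0 v0] := (enorm_ge0 u, enorm_ge0 v).
rewrite -(@ler_pXn2r _ 2) ?nnegrE ?addr_ge0 ?enorm_ge0// sqr_enorm sqrrD.
rewrite !sqr_enorm dotDl !dotDr [dot v u]dotC.
by have := dot_le_enorm u v; lra.
Qed.

Lemma enormN u : enorm (- u) = enorm u.
Proof. by rewrite /enorm dotNl dotNr opprK. Qed.

Lemma enormBC u v : enorm (u - v) = enorm (v - u).
Proof. by rewrite -enormN opprB. Qed.

Lemma enormZ a u : 0 <= a -> enorm (a *: u) = a * enorm u.
Proof.
move=> a0; rewrite /enorm dotZl dotZr mulrA -expr2 sqrtrM ?sqr_ge0//.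
by rewrite sqrtr_sqr ger0_norm.
Qed.

Lemma enorm0 : enorm (0 : 'rV[R]_m) = 0.
Proof. by rewrite /enorm dot0l sqrtr0. Qed.

Lemma enorm_triangle v u w : enorm (u - w) <= enorm (u - v) + enorm (v - w).
Proof. by rewrite -{1}(subrK v u) -addrA; exact: enormD. Qed.

(** Gram-Schmidt: a vector of V outside the span of the rows, minus its
    projection onto this span, is normalized and added as a row. *)
Lemma exists_orthonormal_rows (V : {vspace 'rV[R]_m}) d : (d <= \dim V)%N ->
  exists B : 'M[R]_(d, m), (forall i, row i B \in V) /\ B *m B^T = 1%:M.
Proof.
elim: d => [_|d IH dV].
  by exists 0; split=> [[]//|]; rewrite [LHS]flatmx0 [RHS]flatmx0.
have [B [BV BB]] := IH (ltnW dV).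
pose W := <<[tuple row i B | i < d]>>%VS.
have rowW i : row i B \in W.
  by apply: memv_span; apply/mapP; exists i; rewrite ?mem_enum.
have WV : (W <= V)%VS.
  by apply/span_subvP => _ /mapP[i _ ->].
have : ~~ (V <= W)%VS.
  apply: contraL dV => /dimvS VW; rewrite -leqNgt (leq_trans VW)//.
  by rewrite (leq_trans (dim_span _))// size_tuple.
move=> /subvPn[v vV vW].
have [pW pP] := oprojP W v; set p := oproj W v in pW pP.
have up0 : v - p != 0 by rewrite subr_eq0; apply: contra vW => /eqP->.
have nu0 : enorm (v - p) != 0.
  by rewrite sqrtr_eq0 -ltNge lt_neqAle dot_ge0 andbT eq_sym;
     apply: contra up0 => /eqP/dot_eq0->.
pose e := (enorm (v - p))^-1 *: (v - p).
have ee : dot e e = 1.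
  by rewrite /e dotZl dotZr -sqr_enorm; field.
have eB i : dot e (row i B) = 0 by rewrite /e dotZl pP// mulr0.
exists (col_mx e B : 'M[R]_(1 + d, m)); split.
  move=> i; case: (split_ordP (i : 'I_(1 + d))) => j ->.
    by rewrite (@rowKu _ 1) [row j e](_ : _ = e) ?memvZ ?memvB//;
       [exact: subvP pW|apply/rowP => l; rewrite mxE ord1].
  by rewrite (@rowKd _ 1).
rewrite (@tr_col_mx _ 1 d) (@mul_col_row _ 1 d m 1 d) BB.
rewrite (_ : e *m e^T = 1%:M); last first.
  by apply/matrixP => i j; rewrite (ord1 i) (ord1 j) -dotE ee mxE eqxx.
rewrite (_ : e *m B^T = 0); last first.
  apply/matrixP => i j; rewrite (ord1 i) [RHS]mxE -[RHS](eB j) dotE !mxE.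
  by apply: eq_bigr => l _; rewrite !mxE.
rewrite (_ : B *m e^T = 0) -?scalar_mx_block//.
apply/matrixP => i j; rewrite (ord1 j) [RHS]mxE -[RHS](eB i) dotC dotE !mxE.
by apply: eq_bigr => l _; rewrite !mxE.
Qed.

(** Coordinates in an orthonormal basis identify the orthogonal projection onto
    a subspace with a linear map onto a fixed Euclidean space, so that subspaces
    of the same dimension can be compared. *)
Lemma oproj_coordinates (V : {vspace 'rV[R]_m}) :
  exists B : 'M[R]_(\dim V, m), forall u, enorm (u *m B^T) = enorm (oproj V u).
Proof.
have [B [BV BB]] := exists_orthonormal_rows (leqnn (\dim V)).
exists B => u; have [pV pP] := oprojP V u; set p := oproj V u in pV pP *.
have -> : u *m B^T = p *m B^T.
  apply/eqP; rewrite -subr_eq0 -mulmxBl; apply/eqP/rowP => j.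
  rewrite [RHS]mxE -[RHS](pP _ (BV j)) dotE !mxE.
  by apply: eq_bigr => l _; rewrite !mxE.
have rowsE (c : 'rV[R]_(\dim V)) :
    \sum_i c 0 i *: [tuple row i B | i < \dim V]`_i = c *m B.
  by rewrite mulmx_sum_row; apply: eq_bigr => i _; rewrite -tnth_nth tnth_mktuple.
have freeB : free [tuple row i B | i < \dim V].
  apply/freeP => c c0 i.
  have := rowsE (\row_i c i).
  under eq_bigr do rewrite mxE.
  rewrite c0 => /(congr1 (mulmx^~ B^T)); rewrite mul0mx -mulmxA BB mulmx1.
  by move=> /rowP/(_ i); rewrite !mxE.
have basisB : basis_of V [tuple row i B | i < \dim V].
  rewrite basisEfree freeB size_tuple leqnn andbT /=.
  by apply/span_subvP => _ /mapP[i _ ->].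
have [c ->] : exists c : 'rV[R]_(\dim V), p = c *m B.
  exists (\row_i coord [tuple row i B | i < \dim V] i p).
  rewrite -rowsE [LHS](coord_basis basisB)//.
  by apply: eq_bigr => i _; rewrite mxE.
rewrite -mulmxA BB mulmx1 /enorm !dotE trmx_mul mulmxA -(mulmxA c) BB.
by rewrite mulmx1.
Qed.

End EuclideanNorm.

Section GraphProjection.
Context {R : realType} {n : nat}.
Implicit Types x y : heis R n.

Lemma enorm_le_knorm x : enorm x.1 <= knorm x.
Proof.
rewrite -(@ler_pXn2r _ 4) ?nnegrE ?enorm_ge0 ?knorm_ge0// knorm4.
by rewrite (exprM _ 2 2) sqr_enorm lerDl mulr_ge0 ?sqr_ge0.
Qed.

Lemma knorm_horizontal (z : 'rV[R]_(n + n)) : knorm ((z, 0) : heis R n) = enorm z.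
Proof.
by rewrite /knorm/= expr0n/= mulr0 addr0 (exprM _ 2 2) !sqrtr_sqr
  ger0_norm ?sqr_ge0// sqrtr_sqr ger0_norm ?enorm_ge0.
Qed.

Lemma setdist_lt (T : metricType R) (x : T) (A : set T) (r : R) :
  (setdist x A < r%:E)%E -> exists2 a, A a & mdist x a < r.
Proof.
by move=> /ereal_inf_lt[_ [a Aa <-]]; rewrite lte_fin; exists a.
Qed.

(** A point of the group is the product of its horizontal and its vertical
    projection, and for the left translated differences of points of an intrinsic
    graph of constant less than 1 the latter is dominated by the former. So the
    horizontal projection is bi-Lipschitz on the graph and, up to an additive
    error, near it. *)
Lemma ilip_graph_projection (k : nat) (eta : R) (Gamma : set (heis R n)) :
  0 < eta < 1 -> ilip_graph k eta Gamma ->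
  exists h : heis R n -> 'rV[R]_k,
    (forall x y, enorm (h x - h y) <= mdist x y) /\
    (forall x y a, (setdist x Gamma < a%:E)%E -> (setdist y Gamma < a%:E)%E ->
       mdist x y <= 2 * enorm (h x - h y) + 6 * a).
Proof.
move=> /andP[eta0 eta1] [V [phi [[dimV _] _ [L0 L00 phiL0] etaP ->]]].
subst k; have [B BP] := oproj_coordinates V.
have [L /= [L0' phiL] L1] : exists2 L, 0 < L /\ ilip_with V phi L & L < 1.
  have inf1 : ilip_const V phi < 1 by exact: le_lt_trans etaP eta1.
  by apply: inf_lt inf1; exists L0.
pose h x := x.1 *m B^T.
have hB x y : enorm (h x - h y) = enorm (oproj V (x.1 - y.1)).
  by rewrite /h -mulmxBl BP.
have hmul x y : enorm (h x - h y) = knorm (hproj V (y^-1 * x)%g).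
  by rewrite /hproj knorm_horizontal hB/= addrC.
have oproj_le u : enorm (oproj V u) <= enorm u.
  have [pV pP] := oprojP V u.
  rewrite -(@ler_pXn2r _ 2) ?nnegrE ?enorm_ge0// !sqr_enorm.
  have := pP _ pV; have := dot_ge0 (u - oproj V u).
  rewrite !(dotDl, dotDr, dotNl, dotNr) [dot (oproj V u) u]dotC; lra.
have hle x y : enorm (h x - h y) <= mdist x y.
  rewrite hB (le_trans (oproj_le _))// mdist_heisE.
  by rewrite (le_trans _ (enorm_le_knorm _))//= addrC.
exists h; split=> // x y a /setdist_lt[_ [v Vv <-] xp] /setdist_lt[_ [w Vw <-] yq].
set p := graph_map phi v in xp; set q := graph_map phi w in yq.
have pq : mdist p q <= 2 * enorm (h p - h q).
  have := phiL v w Vv Vw; rewrite -/p -/q /= hmul mdist_heisE => vp.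
  set u := (q^-1 * p)%g in vp *.
  have uE : u = (hproj V u * vproj V u)%g by rewrite /vproj mulgA mulgV mul1g.
  rewrite [in leLHS]uE.
  have := knormM (hproj V u) (vproj V u).
  have : L * knorm (hproj V u) <= 1 * knorm (hproj V u).
    by rewrite ler_wpM2r ?knorm_ge0// ltW.
  lra.
have xy : mdist x y <= mdist x p + mdist p q + mdist y q.
  rewrite -addrA (metric_sym y q); have := metric_triangle x p y.
  have := metric_triangle p q y; lra.
have := enorm_triangle (h x) (h p) (h q); have := enorm_triangle (h y) (h x) (h q).
have := hle x p; have := hle y q; rewrite (enormBC (h p) (h x)); lra.
Qed.

End GraphProjection.

(** * Finite colourings of the Heisenberg group *)

Section Colouring.
Context {R : realType}.

Lemma int_colouring N :
  exists c : int -> 'I_N.+1, forall a b, c a = c b -> a = b \/ N.+1%:Z <= `|a - b|.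
Proof.
have modlt (a : int) : (`|(a %% N.+1)%Z|%N < N.+1)%N.
  by rewrite -ltz_nat gez0_abs ?modz_ge0// ltz_pmod.
exists (fun a => Ordinal (modlt a)) => a b /(congr1 val)/= ab.
have [->|anb] := eqVneq a b; [by left|right].
have : (a = b %[mod N.+1])%Z.
  by rewrite -[LHS]gez0_abs ?modz_ge0// -[RHS]gez0_abs ?modz_ge0// ab.
move=> /eqP; rewrite eqz_mod_dvd => /dvdzP[q qE]; rewrite qE normrM.
rewrite ler_peMl// -gtz0_ge1 normr_gt0.
by apply: contra_neq anb => q0; apply/eqP; rewrite -subr_eq0 qE q0 mul0r.
Qed.

(** The cells of a grid of mesh s are coloured periodically, so that at least N cells
    lie between two cells of the same colour. *)
Lemma real_colouring N (s : R) : 0 < s -> exists c : R -> 'I_N.+1,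
  forall a b, c a = c b -> Num.floor (a / s) = Num.floor (b / s) \/
                           N%:R * s <= `|a - b|.
Proof.
move=> s0; have [c cP] := int_colouring N.
exists (fun a => c (Num.floor (a / s))) => a b /cP[->|H]; [by left|right].
rewrite -ler_pdivlMr// -[X in _ / X](gtr0_norm s0) -normf_div mulrBl.
move: (a / s) (b / s) H => {}a {}b.
rewrite -(ler_int R) -pmulrn -natr1 intr_norm rmorphB/= => ab.
have := floor_itv a; have := floor_itv b; rewrite !intrD1.
move=> /andP[b1 b2] /andP[a1 a2].
have := ler_norm (a - b); have := ler_norm (b - a); rewrite (distrC b).
by rewrite ler_normr in ab; case/orP: ab; lra.
Qed.

Lemma same_floor (s a b : R) : 0 < s ->
  Num.floor (a / s) = Num.floor (b / s) -> `|a - b| <= s.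
Proof.
move=> s0 ab; rewrite -[leRHS]mul1r -ler_pdivrMr//.
rewrite -[X in _ / X](gtr0_norm s0) -normf_div mulrBl.
have := floor_itv (a / s); have := floor_itv (b / s); rewrite ab !intrD1.
by move=> /andP[b1 b2] /andP[a1 a2]; rewrite ler_norml; lra.
Qed.

Section HeisenbergColouring.
Context {n : nat}.
Implicit Types (z w : 'rV[R]_(n + n)) (x y : heis R n).

Let omegaDl z z' w : omega (z + z') w = omega z w + omega z' w.
Proof.
rewrite /omega -mulrDr -big_split; congr (_ * _).
by apply: eq_bigr => i _; rewrite !mxE /=; ring.
Qed.

Let omegaDr z w w' : omega z (w + w') = omega z w + omega z w'.
Proof.
rewrite /omega -mulrDr -big_split; congr (_ * _).
by apply: eq_bigr => i _; rewrite !mxE /=; ring.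
Qed.

Let omegaNl z w : omega (- z) w = - omega z w.
Proof.
rewrite /omega -mulrN -sumrN; congr (_ * _).
by apply: eq_bigr => i _; rewrite !mxE /=; ring.
Qed.

Let omegaNr z w : omega z (- w) = - omega z w.
Proof.
rewrite /omega -mulrN -sumrN; congr (_ * _).
by apply: eq_bigr => i _; rewrite !mxE /=; ring.
Qed.

Let omegazz z : omega z z = 0.
Proof. by rewrite /omega big1 ?mulr0// => i _; ring. Qed.

Let omega_le (s : R) z w : (forall i, `|z 0 i| <= s) -> (forall i, `|w 0 i| <= s) ->
  `|omega z w| <= n%:R * s ^+ 2.
Proof.
move=> zs ws; rewrite /omega normrM ger0_norm ?invr_ge0//.
rewrite mulrC ler_pdivrMr// -mulrA mulr_natl.
apply: le_trans (ler_norm_sum _ _ _) _.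
rewrite -[n in leRHS](card_ord n) -sumr_const; apply: ler_sum => i _.
have M (j j' : 'I_(n + n)) : `|z 0 j * w 0 j'| <= s ^+ 2.
  by rewrite normrM expr2 ler_pM.
by apply: le_trans (ler_normB _ _) _; rewrite mulr_natr mulr2n lerD.
Qed.

Let dot_le (s : R) z : (forall i, `|z 0 i| <= s) ->
  dot z z <= (n + n)%:R * s ^+ 2.
Proof.
move=> zs; rewrite /dot mulr_natl -[X in _ *+ X](card_ord (n + n)) -sumr_const.
apply: ler_sum => i _.
by rewrite -expr2 -[leLHS]real_normK ?num_real// ler_pXn2r ?nnegrE// (le_trans _ (zs i)).
Qed.

Let entry_le_knorm x i : `|x.1 0 i| <= knorm x.
Proof.
apply: le_trans (enorm_le_knorm x).
rewrite -(@ler_pXn2r _ 2) ?nnegrE ?enorm_ge0// sqr_enorm real_normK ?num_real//.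
rewrite /dot (bigD1 i)//= -expr2 lerDl.
by apply: sumr_ge0 => j _; rewrite -expr2 sqr_ge0.
Qed.

(** The cells are the translates of a small box by the points of a lattice, in the
    sense of the group law, and the colours are the residues of their lattice
    coordinates. In the central coordinate, the shear coming from the group law is
    removed by subtracting the form evaluated at the corner of the cell; what
    remains of the shear is quadratic in the cell size. *)
Lemma heis_colouring (Lam : R) : 0 < Lam -> exists K : finType,
  forall s : R, 0 < s -> exists c : heis R n -> K,
    forall x y, c x = c y -> mdist x y <= s \/ Lam * s <= mdist x y.
Proof.
move=> Lam0; pose a : R := 20 * n.+1%:R; pose b : R := Lam * a.
have a0 : 0 < a by rewrite mulr_gt0.
have b0 : 0 < b by rewrite mulr_gt0.
pose N := (Num.truncn (n%:R + b + b ^+ 2)).+1.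
have bN : n%:R + b + b ^+ 2 <= N%:R by rewrite ltW// truncnS_gt.
exists ({ffun 'I_(n + n) -> 'I_N.+1} * 'I_N.+1)%type => s s0.
pose sg := s / a.
have sg0 : 0 < sg by rewrite divr_gt0.
have sE : s = a * sg by rewrite /sg mulrC divfK// gt_eqF.
clearbody sg.
have [c1 c1P] := real_colouring N sg0.
have [c2 c2P] := real_colouring N (exprn_gt0 2 sg0).
pose g x : 'rV[R]_(n + n) := \row_i ((Num.floor (x.1 0 i / sg))%:~R * sg).
pose t x := x.2 - omega (g x) x.1.
exists (fun x => ([ffun i => c1 (x.1 0 i)], c2 (t x))) => x y [/ffunP c1xy c2xy].
have [[i iN]|far1] := pselect (exists i, N%:R * sg <= `|x.1 0 i - y.1 0 i|).
  right; rewrite mdist_heisE; apply: le_trans (entry_le_knorm _ i) => /=.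
  rewrite !mxE addrC (le_trans _ iN)// sE mulrA ler_pM2r// -/b.
  by apply: le_trans bN; have := sqr_ge0 b; have := ler0n R n; lra.
have cell i : Num.floor (x.1 0 i / sg) = Num.floor (y.1 0 i / sg).
  have := c1xy i; rewrite !ffunE => /c1P[//|iN].
  by case: far1; exists i.
have gxy : g x = g y by apply/rowP => i; rewrite !mxE cell.
pose w := x.1 - y.1; pose u := y.1 - g y.
have wsg i : `|w 0 i| <= sg by rewrite !mxE; exact: same_floor.
have usg i : `|u 0 i| <= sg.
  rewrite !mxE -[X in X - _](divfK (lt0r_neq0 sg0)) -mulrBl normrM (gtr0_norm sg0).
  rewrite ler_piMl ?ltW// ger0_norm.
    by have /andP[_] := floor_itv (y.1 0 i / sg); rewrite intrD1; lra.
  by have /andP[] := floor_itv (y.1 0 i / sg); lra.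
have tE : (y^-1 * x)%g.2 = t x - t y - omega u w.
  rewrite /= /t gxy /w /u !(omegaDl, omegaDr, omegaNl, omegaNr) omegazz; ring.
have w1 : (y^-1 * x)%g.1 = w by rewrite /= addrC.
have om := omega_le usg wsg.
have d4 := knorm4 (y^-1 * x)%g; rewrite tE w1 in d4.
have n0 : (0 : R) <= n%:R by [].
have sg2 : 0 < sg ^+ 2 by rewrite exprn_gt0.
case: (c2P _ _ c2xy) => [/same_floor|] tN; [left|right].
  have {}tN := tN sg2.
  rewrite mdist_heisE -(@ler_pXn2r _ 4) ?nnegrE ?knorm_ge0//; last exact: ltW.
  rewrite d4.
  have T2 : (t x - t y - omega u w) ^+ 2 <= (n.+1%:R * sg ^+ 2) ^+ 2.
    rewrite -[leLHS]real_normK ?num_real// ler_pXn2r ?nnegrE//; last first.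
      by rewrite mulr_ge0// ltW.
    by apply: le_trans (ler_normB _ _) _; rewrite -natr1; lra.
  have D2 : dot w w ^+ 2 <= (2 * n.+1%:R * sg ^+ 2) ^+ 2.
    have d1 : dot w w <= 2 * n.+1%:R * sg ^+ 2.
      apply: le_trans (dot_le wsg) _.
      by rewrite ler_pM2r// -natr1 natrD; lra.
    by rewrite !(expr2 (_ * _)) (expr2 (dot _ _)) ler_pM// dot_ge0.
  apply: (@le_trans _ _ (20 * n.+1%:R ^+ 2 * sg ^+ 4)).
    have -> : 20 * n.+1%:R ^+ 2 * sg ^+ 4 = (2 * n.+1%:R * sg ^+ 2) ^+ 2
      + 16 * (n.+1%:R * sg ^+ 2) ^+ 2 by ring.
    lra.
  rewrite sE exprMn ler_pM2r ?exprn_gt0// /a.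
  have : 1 <= n.+1%:R ^+ 2 :> R by rewrite expr_ge1// ler1n.
  rewrite exprMn (exprM n.+1%:R 2 2) => n1.
  by rewrite ler_pM ?sqr_ge0 ?ler_eXnr ?ler1n.
rewrite mdist_heisE -(@ler_pXn2r _ 4) ?nnegrE ?knorm_ge0//; last first.
  by rewrite mulr_ge0// ltW.
rewrite d4.
have bt : b ^+ 2 * sg ^+ 2 <= `|t x - t y - omega u w|.
  have := ler_normD (t x - t y - omega u w) (omega u w); rewrite subrK.
  have : (n%:R + b ^+ 2) * sg ^+ 2 <= N%:R * sg ^+ 2 by rewrite ler_pM2r//; lra.
  by lra.
have : (b ^+ 2 * sg ^+ 2) ^+ 2 <= (t x - t y - omega u w) ^+ 2.
  rewrite -[leRHS]real_normK ?num_real// ler_pXn2r ?nnegrE//.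
  by rewrite mulr_ge0 ?sqr_ge0.
have -> : (b ^+ 2 * sg ^+ 2) ^+ 2 = (Lam * s) ^+ 4 by rewrite sE /b; ring.
by have := sqr_ge0 (dot w w); have := sqr_ge0 (t x - t y - omega u w); lra.
Qed.

End HeisenbergColouring.
End Colouring.

(** * Sizes and inclusions of dyadic cubes *)

Section IntegerPowers.
Context {R : realType} (r : R).
Hypothesis r01 : 0 < r < 1.

Let r0 : 0 < r. Proof. by case/andP: r01. Qed.
Let r1 : r < 1. Proof. by case/andP: r01. Qed.

Lemma exprz_le (i j : int) : i <= j -> r ^ j <= r ^ i.
Proof.
move=> ij; rewrite -(subrK i j) expfzDr ?gt_eqF//.
rewrite ler_piMl ?(exprz_ge0 _ (ltW r0))//.
by rewrite -[_ - _]gez0_abs ?subr_ge0// -exprnP exprn_ile1 ?ltW.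
Qed.

Lemma exprz_le_inv (i j : int) : r ^ j < r ^ i -> i < j.
Proof. by move=> ij; rewrite ltNge; apply/negP => /exprz_le; rewrite leNgt ij. Qed.

Lemma exprn_lt (a : R) : 0 < a -> exists n : nat, r ^+ n < a.
Proof.
move=> a0; have /cvgrPdist_lt/(_ _ a0) : (fun n => r ^+ n) @ \oo --> (0 : R).
  by apply: cvg_expr; rewrite gtr0_norm.
move=> [n _ /(_ n (leqnn n))]; rewrite /= sub0r normrN gtr0_norm ?exprn_gt0//.
by exists n.
Qed.

(** Every positive scale falls between two consecutive powers of r; the exponent
    is found by a least-element search started far to the left. *)
Lemma exprz_bracket (a : R) : 0 < a -> exists i : int, r ^ (i + 1) < a <= r ^ i.
Proof.
move=> a0; have [n an] := exprn_lt a0.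
have [m am] : exists m : nat, r ^+ m < a^-1 by apply: exprn_lt; rewrite invr_gt0.
have exP : exists l : nat, r ^ (l%:Z - m%:Z) < a.
  exists (n + m)%N; rewrite PoszD addrK; exact: an.
case: (ex_minnP exP) => -[|l] lP lmin.
  move: lP; rewrite sub0r -invr_expz ltNge => /negP[].
  by rewrite -[leLHS]invrK lef_pV2 ?posrE ?exprz_gt0 ?invr_gt0// ltW.
exists (l%:Z - m%:Z); rewrite leNgt; apply/andP; split.
  by rewrite (_ : _ + 1 = l.+1%:Z - m%:Z)//; lia.
by apply/negP => /lmin; rewrite ltnn.
Qed.

End IntegerPowers.

Section DyadicCubes.
Context {R : realType} {T : metricType R} {k : nat} {E : set T}.
Variable D : dyadic_system k E.
Implicit Types (Q P : set T) (x y : T).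

Local Notation rho := (dy_rho D).
Local Notation M := (dy_const D).

Let rho01 := dy_rho_itv D.

Lemma rho_gt0 : 0 < rho. Proof. by case/andP: rho01. Qed.

Lemma dy_const_gt0 : 0 < M.
Proof. exact: lt_trans (dy_const_gt1 D). Qed.

Lemma dy_gen_up i j : dy_gen D i -> i <= j -> dy_gen D j.
Proof.
have [[_ ->]//|[J0 [_ _ ->]]] := dy_genP D.
by move=> /le_trans; apply.
Qed.

(** A set may be a cube of several generations; one of them is chosen. Generations
    and inclusions need not be compatible: a cube of a finer generation may contain
    a cube of a coarser one, as long as their sizes are comparable. For this reason
    the combinatorics below rests on inclusions and diameters. *)
Definition level Q : int := xget 0 [set j | dy_gen D j /\ dy_level D j Q].

Definition rdiam (A : set T) : R := fine (diam A).

Lemma levelP Q : cubes D Q -> dy_gen D (level Q) /\ dy_level D (level Q) Q.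
Proof.
move=> [j gj Qj]; rewrite /level; case: xgetP => [i _ //|/(_ j)].
by case; split.
Qed.

Lemma rdiamP j Q : dy_gen D j -> dy_level D j Q ->
  M^-1 * rho ^ j <= rdiam Q <= M * rho ^ j /\ diam Q = (rdiam Q)%:E.
Proof.
move=> gj Qj; have := dy_diam gj Qj; rewrite /rdiam.
case: (diam Q) => [d| |] /andP[].
- by rewrite !lee_fin => -> ->.
- by rewrite leye_eq.
- by rewrite leeNy_eq.
Qed.

Lemma diamE Q : cubes D Q -> diam Q = (rdiam Q)%:E.
Proof. by move=> [j gj Qj]; have [] := rdiamP gj Qj. Qed.

Lemma rdiam_le Q : cubes D Q -> rdiam Q <= M * rho ^ level Q.
Proof. by move=> /levelP[gj /(rdiamP gj)[/andP[]]]. Qed.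

Lemma rdiam_ge Q : cubes D Q -> M^-1 * rho ^ level Q <= rdiam Q.
Proof. by move=> /levelP[gj /(rdiamP gj)[/andP[]]]. Qed.

Lemma rdiam_gt0 Q : cubes D Q -> 0 < rdiam Q.
Proof.
move=> /rdiam_ge; apply: lt_le_trans.
by rewrite mulr_gt0 ?invr_gt0 ?dy_const_gt0// exprz_gt0// rho_gt0.
Qed.

Lemma mdist_le_diam (A : set T) x y : A x -> A y -> ((mdist x y)%:E <= diam A)%E.
Proof.
move=> Ax Ay; rewrite /diam le_max; apply/orP; right.
by apply: ereal_sup_ubound; exists (x, y).
Qed.

Lemma mdist_le_rdiam Q x y : cubes D Q -> Q x -> Q y -> mdist x y <= rdiam Q.
Proof. by move=> cQ Qx Qy; rewrite -lee_fin -diamE//; exact: mdist_le_diam. Qed.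

Lemma le_diam (A B : set T) : A `<=` B -> (diam A <= diam B)%E.
Proof.
move=> AB; rewrite /diam ge_max le_max lexx /= le_max; apply/orP; right.
by apply: ereal_sup_le => _ [[x y] [/= Ax Ay] <-]; exists (x, y) => //;
   split=> /=; exact: AB.
Qed.

Lemma le_rdiam Q P : cubes D Q -> cubes D P -> Q `<=` P -> rdiam Q <= rdiam P.
Proof. by move=> cQ cP QP; rewrite -lee_fin -!diamE//; exact: le_diam. Qed.

Lemma cube_nonempty Q : cubes D Q -> Q !=set0.
Proof.
move=> cQ; apply/set0P/eqP => Q0; have := rdiam_gt0 cQ.
by rewrite Q0 /rdiam diam_set0 ltxx.
Qed.

Lemma cube_sub Q : cubes D Q -> Q `<=` E.
Proof. by move=> [j gj Qj]; rewrite (dy_cover gj) => x Qx; exists Q. Qed.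

Lemma exists_cube j x : dy_gen D j -> E x -> exists2 Q, dy_level D j Q & Q x.
Proof. by move=> gj; rewrite {1}(dy_cover gj) => -[Q Qj Qx]; exists Q. Qed.

Lemma cube_nested Q P x : cubes D Q -> cubes D P -> Q x -> P x ->
  Q `<=` P \/ P `<=` Q.
Proof.
by move=> [i gi Qi] [j gj Pj] Qx Px; apply: (dy_nested gi gj Qi Pj); exists x.
Qed.

(** Taking the cube of the right size around the point, or Q itself when this cube
    is not smaller than Q. *)
Lemma intermediate_cube Q x (d : R) : cubes D Q -> Q x -> 0 < d -> d <= rdiam Q ->
  exists P, [/\ cubes D P, P x, P `<=` Q, d <= rdiam P & rdiam P <= M ^+ 2 / rho * d].
Proof.
move=> cQ Qx d0 dQ; have M0 := dy_const_gt0; have rho0 := rho_gt0.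
have Md0 : 0 < M * d by rewrite mulr_gt0.
have [i /andP[i1 i2]] := exprz_bracket rho01 Md0.
have di : d <= M^-1 * rho ^ i by rewrite ler_pdivlMl.
have id : M * rho ^ i <= M ^+ 2 / rho * d.
  rewrite mulrAC ler_pdivlMr// -mulrA expr2 -mulrA ler_pM2l// ltW//.
  by move: i1; rewrite expfzDr ?gt_eqF// expr1z.
have [gl Ql] := levelP cQ.
have [il|li] := leP i (level Q).
  exists Q; split=> //; apply: le_trans id.
  apply: le_trans (rdiam_le cQ) _; rewrite ler_pM2l//; exact: exprz_le.
have gi := dy_gen_up gl (ltW li).
have [P Pi Px] := exists_cube gi (cube_sub cQ Qx).
have cP : cubes D P by exists i.
have [/andP[P1 P2] _] := rdiamP gi Pi.
have [PQ|QP] := cube_nested cP cQ Px Qx.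
  by exists P; split=> //; [exact: le_trans P1|exact: le_trans id].
exists Q; split=> //; apply: le_trans id; apply: le_trans P2.
exact: le_rdiam.
Qed.

Lemma max_in_chain (P : set T -> Prop) (f : nat -> set T) N :
  (forall i j, P (f i) -> P (f j) -> f i `<=` f j \/ f j `<=` f i) ->
  (exists2 i, (i < N)%N & P (f i)) ->
  exists i, P (f i) /\ forall j, (j < N)%N -> P (f j) -> f j `<=` f i.
Proof.
move=> Ptot; elim: N => [[]//|N IH [i iN Pi]].
have [/IH[l [Pl lmax]]|noP] := pselect (exists2 i, (i < N)%N & P (f i)).
  have [PN|nPN] := pselect (P (f N)); last first.
    exists l; split=> // j; rewrite ltnS leq_eqVlt => /predU1P[->//|].
    exact: lmax.
  have [lN|Nl] := Ptot _ _ Pl PN.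
    exists N; split=> // j; rewrite ltnS leq_eqVlt => /predU1P[-> _ //|jN Pj].
    exact: subset_trans (lmax _ jN Pj) lN.
  exists l; split=> // j; rewrite ltnS leq_eqVlt => /predU1P[->//|].
  exact: lmax.
exists i; split=> // j jN Pj.
have iE : i = N.
  move: iN; rewrite ltnS leq_eqVlt => /predU1P[//|iN].
  by case: noP; exists i.
move: jN; rewrite ltnS leq_eqVlt iE => /predU1P[->//|jN].
by case: noP; exists j.
Qed.

(** Only finitely many generations lie between a given cube and the ambient one, and
    each of them contributes at most one cube around the point. *)
Lemma exists_largest (R0 : set T) x (P : set (set T)) : cubes D R0 ->
  (forall Q, P Q -> [/\ cubes D Q, Q `<=` R0 & Q x]) -> P !=set0 ->
  exists2 Q, P Q & forall Q', P Q' -> Q' `<=` Q.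
Proof.
move=> cR P_cube [Q0 PQ0]; have M0 := dy_const_gt0; have rho0 := rho_gt0.
have [cQ0 Q0R Q0x] := P_cube _ PQ0.
have [m rm] : exists m : nat, rho ^+ m < M ^- 2.
  by apply: exprn_lt => //; rewrite invr_gt0 exprn_gt0.
have below Q Q' : cubes D Q -> cubes D Q' -> Q `<=` Q' -> level Q' - m%:Z <= level Q.
  move=> cQ cQ' QQ'; rewrite leNgt; apply/negP => lt.
  have /(exprz_le rho01) : level Q + m%:Z <= level Q' by rewrite -lerBrDr ltW.
  rewrite expfzDr ?gt_eqF// -exprnP => lQ'.
  have := le_rdiam cQ cQ' QQ'; rewrite leNgt => /negP; apply.
  apply: le_lt_trans (rdiam_le cQ') _; apply: lt_le_trans (rdiam_ge cQ).
  apply: (@le_lt_trans _ _ (M * (rho ^ level Q * rho ^+ m))).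
    by rewrite ler_pM2l.
  rewrite mulrCA mulrC ltr_pM2r ?exprz_gt0//.
  by rewrite -(ltr_pM2l M0) mulrA -expr2 mulfV ?gt_eqF// -ltr_pdivlMl ?exprn_gt0// mulr1.
pose f (i : nat) := xget set0 [set Q | dy_gen D (level R0 - m%:Z + i%:Z) /\
  dy_level D (level R0 - m%:Z + i%:Z) Q /\ Q x].
have fP Q : P Q -> exists2 i, f i = Q & level R0 - m%:Z + i%:Z = level Q.
  move=> PQ; have [cQ QR Qx] := P_cube _ PQ.
  have [gl Ql] := levelP cQ.
  have lE : level R0 - m%:Z + `|(level Q - (level R0 - m%:Z))%R|%N%:Z = level Q.
    by rewrite gez0_abs ?subr_ge0; [rewrite addrC subrK|exact: below].
  exists (`|(level Q - (level R0 - m%:Z))%R|%N) => //.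
  rewrite /f lE; case: xgetP => [Q' _ [_ [Q'l Q'x]]|/(_ Q)]; last by case.
  by apply: (dy_disjoint gl) => //; exists x.
pose P' Q := P Q /\ Q0 `<=` Q.
pose N := `|(level Q0 + m%:Z - (level R0 - m%:Z))%R|%N.+1.
have f_lt i Q : P' Q -> level R0 - m%:Z + i%:Z = level Q -> (i < N)%N.
  move=> [PQ Q0Q] iE; have [cQ _ _] := P_cube _ PQ.
  have := below _ _ cQ0 cQ Q0Q; rewrite -iE => le1.
  rewrite /N ltnS -lez_nat gez0_abs; first by rewrite -lerBDr in le1 *; lia.
  by have := below _ _ cQ0 cR Q0R; lia.
have [| |i [[Pi Q0i] imax]] := @max_in_chain P' f N.
- move=> i j [Pi _] [Pj _]; have [ci _ xi] := P_cube _ Pi.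
  by have [cj _ xj] := P_cube _ Pj; exact: (cube_nested ci cj xi xj).
- have PQ0' : P' Q0 by split.
  by have [i fi iE] := fP _ PQ0; exists i; rewrite ?fi//; exact: f_lt iE.
exists (f i) => // Q' PQ'; have [cQ' _ Q'x] := P_cube _ PQ'.
have [Q'Q0|Q0Q'] := cube_nested cQ' cQ0 Q'x Q0x; first exact: subset_trans Q0i.
have [j fj jE] := fP _ PQ'; rewrite -fj; apply: imax; rewrite ?fj//.
exact: f_lt jE.
Qed.

End DyadicCubes.

(** * Special cubes, codes and expanding maps *)

Section LinearEstimates.
Context {R : realFieldType}.

Lemma attached_le (lam a dQ dq e g : R) :
  lam * g <= 2 * lam * a -> 0 < a -> a <= dQ -> dq <= dQ -> e <= dq ->
  lam * a <= a / 32 -> e + lam * g <= 2 * dQ.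
Proof. lra. Qed.

Lemma separated_ge (d h z z' e a b c : R) :
  d <= 4 * h -> z <= 3 * d / 32 -> z' <= z -> a <= 2 * (d / 32) ->
  b <= 2 * (d / 32) -> 0 <= d -> c <= b + a -> h <= e + c -> z' <= e.
Proof. lra. Qed.

End LinearEstimates.

Section SpecialCubes.
Context {R : realType} {T : metricType R} {k : nat} {E : set T}.
Variables (D : dyadic_system k E) (R0 : set T) (Sp : set (set T)).
Hypothesis cubeR0 : cubes D R0.
Hypothesis Sp_cube : forall Q, Sp Q -> cubes D Q.
Hypothesis Sp_sub : forall Q, Sp Q -> Q `<=` R0.
Implicit Types (Q P : set T) (x y : T).

Local Notation rho := (dy_rho D).
Local Notation M := (dy_const D).

Definition maximal_in Q Q' : Prop :=
  [/\ Sp Q', Q' `<=` Q, Q' <> Q &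
      forall P, Sp P -> Q' `<=` P -> P `<=` Q -> P <> Q -> P = Q'].

Lemma maximal_in_sub Q Q' P x : maximal_in Q Q' -> Q' x ->
  Sp P -> P x -> P `<=` Q -> P <> Q -> P `<=` Q'.
Proof.
move=> [SQ' Q'Q Q'neq Q'max] Q'x SP Px PQ Pneq.
have [//|Q'P] := cube_nested (Sp_cube SP) (Sp_cube SQ') Px Q'x.
by rewrite (Q'max P).
Qed.

Lemma maximal_in_uniq Q Q1 Q2 x : maximal_in Q Q1 -> maximal_in Q Q2 ->
  Q1 x -> Q2 x -> Q1 = Q2.
Proof.
move=> m1 m2 Q1x Q2x; have [S1 Q1Q Q1neq _] := m1; have [S2 Q2Q Q2neq _] := m2.
apply/seteqP; split.
  exact: (maximal_in_sub m2 Q2x).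
exact: (maximal_in_sub m1 Q1x).
Qed.

Lemma exists_maximal_in Q P x : Sp P -> P `<=` Q -> P <> Q -> P x ->
  exists2 Q', maximal_in Q Q' & Q' x.
Proof.
move=> SP PQ Pneq Px.
have [Q' [SQ' Q'Q Q'neq Q'x] Q'max] := @exists_largest _ _ _ _ D R0 x
    [set Q' | [/\ Sp Q', Q' `<=` Q, Q' <> Q & Q' x]] cubeR0
    (fun Q' H => let: And4 SQ' _ _ Q'x := H in
                 And3 (Sp_cube SQ') (Sp_sub SQ') Q'x)
    (ex_intro _ P (And4 SP PQ Pneq Px)).
exists Q' => //; split=> // P' SP' Q'P' P'Q P'neq.
by apply/seteqP; split=> //; apply: Q'max; split=> //; exact: Q'P'.
Qed.

Fixpoint descendant (i : nat) Q Q' : Prop :=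
  if i is i'.+1 then exists2 P, maximal_in Q P & descendant i' P Q' else Q' = Q.

Lemma descendant_Sp i Q Q' : Sp Q -> descendant i Q Q' -> Sp Q'.
Proof.
by elim: i Q => [|i IH] Q SQ /=; [move->|move=> [P [SP _ _ _]]; exact: IH].
Qed.

Lemma descendant_sub i Q Q' : descendant i Q Q' -> Q' `<=` Q.
Proof.
elim: i Q => [|i IH] Q /=; first by move->.
by move=> [P [_ PQ _ _] /IH]; move=> /subset_trans; exact.
Qed.

Lemma descendant_uniq i j Q Q' : Sp Q' ->
  descendant i Q Q' -> descendant j Q Q' -> i = j.
Proof.
move=> SQ'; elim: i j Q => [|i IH] [|j] Q //=.
- move=> -> [P [_ PQ Pneq _] /descendant_sub QP].
  by case: Pneq; apply/seteqP.
- move=> [P [_ PQ Pneq _] /descendant_sub Q'P] Q'Q.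
  by case: Pneq; apply/seteqP; rewrite -{2}Q'Q.
move=> [P mP dP] [P' mP' dP'].
have [x Q'x] := cube_nonempty (Sp_cube SQ').
have PP' : P = P'.
  apply: (maximal_in_uniq mP mP' (x := x)).
    exact: descendant_sub dP _ Q'x.
  exact: descendant_sub dP' _ Q'x.
by rewrite (IH j P)// PP'.
Qed.

Lemma descendant_prefix i j Q Q' : (i <= j)%N -> descendant j Q Q' ->
  exists2 P, descendant i Q P & Q' `<=` P.
Proof.
elim: i j Q => [|i IH] j Q; first by move=> _ /descendant_sub; exists Q.
case: j => [//|j]; rewrite ltnS => ij /= [P mP /(IH _ _ ij)[P' dP' Q'P']].
by exists P' => //; exists P.
Qed.

Section Codes.
Variables (L : finType) (letter : set T -> T -> L).

(** The code of a point in a special cube lists the letters which the point receives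
    from the decreasing chain of special cubes around it. *)
Fixpoint has_code (w : seq L) Q x : Prop :=
  if w is l :: w' then
    exists Q', [/\ maximal_in Q Q', Q' x, letter Q' x = l & has_code w' Q' x]
  else forall P, Sp P -> P `<=` Q -> P x -> P = Q.

Lemma has_code_or_descendant N Q x : Sp Q -> Q x ->
  (exists2 w, (size w < N)%N & has_code w Q x) \/
  (exists2 Q', descendant N Q Q' & Q' x).
Proof.
elim: N Q => [|N IH] Q SQ Qx; first by right; exists Q.
have [noP|/existsNP[P]] := pselect (forall P, Sp P -> P `<=` Q -> P x -> P = Q).
  by left; exists [::].
move=> /not_implyP[SP] /not_implyP[PQ] /not_implyP[Px Pneq].
have [Q' mQ' Q'x] := exists_maximal_in SP PQ Pneq Px.
have [SQ' _ _ _] := mQ'.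
have [[w wN wx]|[P' dP' P'x]] := IH _ SQ' Q'x.
  by left; exists (letter Q' x :: w) => //; exists Q'.
by right; exists P' => //; exists Q'.
Qed.

End Codes.

Section Construction.
Variable A : R.
Hypothesis A_ge : M ^+ 2 / rho <= A.

(** Around each point of Q there is a smaller special cube of comparable size, as is
    the case for bad cubes. *)
Definition shrinking Q : Prop :=
  forall x, Q x -> exists P, [/\ Sp P, P `<=` Q, P <> Q, P x & rdiam Q <= A * rdiam P].

(** A chart expands, up to the factor 4, all distances comparable to the size of
    some cube P inside Q around one of the two points, provided that no smaller
    special cube of Q already contains P. *)
Definition charted Q : Prop := exists h : T -> 'rV[R]_k,
  (forall x y, enorm (h x - h y) <= mdist x y) /\
  forall P x y, cubes D P -> P `<=` Q ->
    (forall Q', Sp Q' -> Q' `<=` Q -> Q' <> Q -> ~ P `<=` Q') ->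
    E x -> P y -> mdist x y <= rdiam P -> rdiam P <= A * mdist x y ->
    mdist x y <= 4 * enorm (h x - h y).

Hypothesis Sp_cases : forall Q, Sp Q -> shrinking Q \/ charted Q.

(* The width tau of the removed boundary layers is much smaller than the accuracy of
   the charts, so the charts alone do not separate two neighbouring maximal
   special cubes. The threshold Lam exceeds A * M, so that points at distance
   Lam * rho ^ j are separated at a scale seen by the charts. *)
Variables (tau Lam : R) (N : nat) (K : finType).
Variables (cz : int -> 'I_N.+1) (cc : int -> T -> K).
Hypothesis tau_itv : 0 < tau <= 1.
Hypothesis Lam_gt : A * M < Lam.
Hypothesis rhoN : Lam * rho ^+ N <= tau.
Hypothesis czP : forall a b, cz a = cz b -> a = b \/ N.+1%:Z <= `|a - b|.
Hypothesis ccP : forall j x y, cc j x = cc j y ->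
  mdist x y <= tau * rho ^ j \/ Lam * rho ^ j <= mdist x y.

Variable Y : set T.
Hypothesis Y_inner : forall x Q y, Y x -> Sp Q -> Q x -> E y ->
  mdist x y <= tau * rho ^ level D Q -> Q y.

Definition letter Q x : 'I_N.+1 * K := (cz (level D Q), cc (level D Q) x).

Let tau0 : 0 < tau. Proof. by case/andP: tau_itv. Qed.
Let rho0 : 0 < rho := rho_gt0 D.
Let M0 : 0 < M := dy_const_gt0 D.
Let M1 : 1 < M := dy_const_gt1 D.
Let A0 : 0 < A.
Proof. by apply: lt_le_trans A_ge; rewrite divr_gt0 ?exprn_gt0. Qed.
Let Lam0 : 0 < Lam.
Proof. by apply: lt_trans Lam_gt; rewrite mulr_gt0. Qed.
Let A1 : 1 <= A.
Proof.
apply: le_trans A_ge; rewrite ler_pdivlMr// mul1r.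
have /andP[_ /ltW r1] := dy_rho_itv D; apply: le_trans r1 _.
by rewrite exprn_ege1// ltW.
Qed.

(** Points of the same colour in two cubes of one generation are far apart, since the
    boundary layers have been removed; two cubes of generations that differ but have
    the same residue differ so much in size that the removed layer of the larger
    one is already huge for the smaller one. *)
Lemma same_letter_separated Q Q1 Q2 x y :
  maximal_in Q Q1 -> maximal_in Q Q2 -> Q1 <> Q2 -> Q1 x -> Q2 y -> Y x -> Y y ->
  letter Q1 x = letter Q2 y ->
  [/\ tau * rho ^ level D Q1 < mdist x y, tau * rho ^ level D Q2 < mdist x y &
      Lam * rho ^ level D Q1 <= mdist x y \/ Lam * rho ^ level D Q2 <= mdist x y].
Proof.
move=> m1 m2 Q12 Q1x Q2y Yx Yy [c12 cxy].
have [S1 _ _ _] := m1; have [S2 _ _ _] := m2.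
have far1 : tau * rho ^ level D Q1 < mdist x y.
  rewrite ltNge; apply/negP => xy; case: Q12; apply: (maximal_in_uniq m1 m2 _ Q2y).
  by apply: (Y_inner Yx S1 Q1x _ xy); exact: cube_sub (Sp_cube S2) _ Q2y.
have far2 : tau * rho ^ level D Q2 < mdist x y.
  rewrite ltNge; apply/negP => xy; case: Q12; apply: (maximal_in_uniq m1 m2 Q1x).
  apply: (Y_inner Yy S2 Q2y _ _); first exact: cube_sub (Sp_cube S1) _ Q1x.
  by rewrite metric_sym.
split=> //.
have far (i j : int) : N.+1%:Z <= j - i -> tau * rho ^ i < mdist x y ->
    Lam * rho ^ j <= mdist x y.
  move=> Nij /ltW; apply: le_trans.
  apply: (@le_trans _ _ (Lam * rho ^ (i + N%:Z))).
    by rewrite ler_pM2l//; apply: exprz_le; [exact: dy_rho_itv|clear -Nij; lia].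
  by rewrite expfzDr ?gt_eqF// -exprnP mulrCA mulrC ler_pM2r ?exprz_gt0.
have [l12|] := czP c12.
  right; rewrite -l12 in cxy *; have [|//] := ccP cxy.
  by rewrite leNgt far1.
rewrite ler_normr => /orP[|] le; first by left; exact: far far2.
by right; apply: far far1; clear -le; lia.
Qed.

(** The distance exceeds the size of one of the two special cubes, hence is the size
    of a cube around one of the points which no special subcube contains. *)
Lemma chart_separated Q h Q1 Q2 x y :
  cubes D Q ->
  (forall P x y, cubes D P -> P `<=` Q ->
    (forall Q', Sp Q' -> Q' `<=` Q -> Q' <> Q -> ~ P `<=` Q') ->
    E x -> P y -> mdist x y <= rdiam P -> rdiam P <= A * mdist x y ->
    mdist x y <= 4 * enorm (h x - h y :> 'rV[R]_k)) ->
  maximal_in Q Q1 -> maximal_in Q Q2 -> Q1 <> Q2 -> Q1 x -> Q2 y -> Y x -> Y y ->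
  letter Q1 x = letter Q2 y -> mdist x y <= 4 * enorm (h x - h y).
Proof.
move=> cQ hP.
have far_case Q3 Q4 z z' : maximal_in Q Q3 -> maximal_in Q Q4 -> Q3 <> Q4 ->
    Q3 z -> Q4 z' -> Y z -> Y z' -> Lam * rho ^ level D Q4 <= mdist z z' ->
    mdist z z' <= 4 * enorm (h z - h z').
  move: Q3 Q4 z z' => {}Q1 {}Q2 {}x {}y m1 m2 Q12 Q1x Q2y Yx Yy far2.
  have [S1 Q1Q _ _] := m1; have [S2 Q2Q Q2neq Q2max] := m2.
  have [Qx Qy] := (Q1Q _ Q1x, Q2Q _ Q2y).
  have d2 : rdiam Q2 < mdist x y.
    apply: lt_le_trans far2; apply: le_lt_trans (rdiam_le (Sp_cube S2)) _.
    rewrite ltr_pM2r ?exprz_gt0//; apply: le_lt_trans Lam_gt.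
    by rewrite ler_peMl// ltW.
  have d0 : 0 < mdist x y := lt_trans (rdiam_gt0 (Sp_cube S2)) d2.
  have [P [cP Py PQ dP Pd]] := intermediate_cube cQ Qy d0 (mdist_le_rdiam cQ Qx Qy).
  apply: (hP P) => //; last 2 first.
  - exact: cube_sub cQ _ Qx.
  - by apply: le_trans Pd _; rewrite ler_pM2r.
  move=> Q' SQ' Q'Q Q'neq PQ'.
  have Q'Q2 := maximal_in_sub m2 Q2y SQ' (PQ' _ Py) Q'Q Q'neq.
  have := le_rdiam cP (Sp_cube S2) (subset_trans PQ' Q'Q2).
  by rewrite leNgt (lt_le_trans d2 dP).
move=> m1 m2 Q12 Q1x Q2y Yx Yy lxy.
have [_ _ farL] := same_letter_separated m1 m2 Q12 Q1x Q2y Yx Yy lxy.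
case: farL => [|far2']; last exact: (far_case Q1 Q2).
rewrite metric_sym enormBC => far1.
exact: (far_case Q2 Q1 y x m2 m1 (nesym Q12)).
Qed.

(** Where no special subcube occurs, the chart is accurate at all scales. *)
Lemma chart_innermost Q h x y :
  cubes D Q ->
  (forall P x y, cubes D P -> P `<=` Q ->
    (forall Q', Sp Q' -> Q' `<=` Q -> Q' <> Q -> ~ P `<=` Q') ->
    E x -> P y -> mdist x y <= rdiam P -> rdiam P <= A * mdist x y ->
    mdist x y <= 4 * enorm (h x - h y :> 'rV[R]_k)) ->
  Q x -> Q y -> (forall P, Sp P -> P `<=` Q -> P y -> P = Q) ->
  mdist x y <= 4 * enorm (h x - h y).
Proof.
move=> cQ hP Qx Qy yQ.
have [d0|] := ltP 0 (mdist x y); last first.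
  by move=> /le_trans; apply; rewrite mulr_ge0 ?enorm_ge0.
have [P [cP Py PQ dP Pd]] := intermediate_cube cQ Qy d0 (mdist_le_rdiam cQ Qx Qy).
apply: (hP P) => //; last 2 first.
- exact: cube_sub cQ _ Qx.
- by apply: le_trans Pd _; rewrite ler_pM2r.
by move=> Q' SQ' Q'Q Q'neq /(_ _ Py)/(yQ _ SQ' Q'Q).
Qed.

Definition coded (w : seq ('I_N.+1 * K)) Q : set T :=
  [set x | [/\ Y x, Q x & has_code letter w Q x]].

Let lam := tau / (32 * M).

Let lam0 : 0 < lam. Proof. by rewrite /lam divr_gt0 ?mulr_gt0. Qed.
Let lam1 : lam <= 1 / 32.
Proof.
rewrite ler_pdivrMr ?mulr_gt0//; case/andP: tau_itv => _.
by have := M1; lra.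
Qed.

(** Inductively on the length of the code. In a special cube with a chart, the
    parametrizations of the maximal special subcubes are scaled down and attached to
    the chart: the images stay close to the chart images of single points of the
    subcubes, which are separated because the letters agree. In a shrinking cube
    all points with the same code lie in the same subcube. *)
Lemma coded_expanding w Q : Sp Q -> exists g : T -> 'rV[R]_k,
  (forall x, coded w Q x -> enorm (g x) <= 2 * rdiam Q) /\
  (forall x y, coded w Q x -> coded w Q y ->
     lam ^+ (size w).+1 * mdist x y <= enorm (g x - g y)).
Proof.
elim: w Q => [|l w IH] Q SQ; have cQ := Sp_cube SQ.
  case: (Sp_cases SQ) => [shr|[h [h1 hP]]].
    exists (fun=> 0); split=> x; last move=> y.
      move=> [_ Qx xQ]; have [P [SP PQ Pneq Px _]] := shr _ Qx.
      by case: Pneq; exact: xQ.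
    move=> [_ Qx xQ]; have [P [SP PQ Pneq Px _]] := shr _ Qx.
    by case: Pneq; exact: xQ.
  have [q Qq] := cube_nonempty cQ.
  exists (fun x => h x - h q); split=> [x [_ Qx _]|x y [_ Qx _] [_ Qy yQ]].
    apply: le_trans (h1 _ _) _; have := mdist_le_rdiam cQ Qx Qq.
    by have := rdiam_gt0 cQ; lra.
  rewrite opprB addrA subrK expr1.
  have := chart_innermost cQ hP Qx Qy yQ; have := lam1.
  have : lam * mdist x y <= 1 / 32 * mdist x y by rewrite ler_wpM2r// mdist_ge0.
  have := mdist_ge0 x y; lra.
have [G GP] : {G : set T -> T -> 'rV[R]_k & forall Q', Sp Q' ->
    (forall x, coded w Q' x -> enorm (G Q' x) <= 2 * rdiam Q') /\
    (forall x y, coded w Q' x -> coded w Q' y ->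
       lam ^+ (size w).+1 * mdist x y <= enorm (G Q' x - G Q' y))}.
  apply: (@choice _ _ (fun Q' g => Sp Q' ->
    (forall x, coded w Q' x -> enorm (g x) <= 2 * rdiam Q') /\
    (forall x y, coded w Q' x -> coded w Q' y ->
       lam ^+ (size w).+1 * mdist x y <= enorm (g x - g y)))) => Q'.
  have [/IH[g gP]|nS] := pselect (Sp Q'); first by exists g.
  by exists (fun=> 0).
have [[x0 x0Q]|noX] := pselect (coded (l :: w) Q !=set0); last first.
  exists (fun=> 0); split=> [x xX|x y xX _]; by case: noX; exists x.
have lamS : lam ^+ (size w).+2 <= lam ^+ (size w).+1.
  by rewrite exprS ler_piMl ?exprn_ge0 ?(ltW lam0)//; have := lam1; lra.
have lamS1 : lam ^+ (size w).+2 <= lam.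
  by rewrite exprS ler_piMr ?(ltW lam0)// exprn_ile1 ?(ltW lam0)//; have := lam1; lra.
case: (Sp_cases SQ) => [shr|[h [h1 hP]]].
  have [_ _ [Q1 [m1 Q1x0 l1 _]]] := x0Q; have [S1 Q1Q _ _] := m1.
  have inQ1 x : coded (l :: w) Q x -> coded w Q1 x.
    move=> [Yx Qx [Q2 [m2 Q2x l2 wx]]].
    suff -> : Q1 = Q2 by split.
    apply: contrapT => Q12; have [Yx0 _ _] := x0Q.
    have [_ _] := same_letter_separated m1 m2 Q12 Q1x0 Q2x Yx0 Yx (etrans l1 (esym l2)).
    have small Q' z : maximal_in Q Q' -> Q' z -> mdist x0 x < Lam * rho ^ level D Q'.
      move=> m' Q'z; have [S' Q'Q _ _] := m'.
      have [P [SP PQ Pneq Pz QP]] := shr _ (Q'Q _ Q'z).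
      have PQ' := maximal_in_sub m' Q'z SP Pz PQ Pneq.
      apply: le_lt_trans (mdist_le_rdiam cQ (Q1Q _ Q1x0) Qx) _.
      apply: le_lt_trans QP _; apply: (@le_lt_trans _ _ (A * (M * rho ^ level D Q'))).
        rewrite ler_pM2l//; apply: le_trans (rdiam_le (Sp_cube S')).
        exact: le_rdiam (Sp_cube SP) (Sp_cube S') PQ'.
      by rewrite mulrA ltr_pM2r ?exprz_gt0.
    by rewrite !leNgt (small _ _ m1 Q1x0) (small _ _ m2 Q2x) => -[].
  have [Gle Gge] := GP _ S1.
  exists (G Q1); split=> [x /inQ1/Gle le|x y /inQ1 xQ /inQ1 yQ].
    by apply: le_trans le _; rewrite ler_pM2l//; exact: le_rdiam (Sp_cube S1) cQ Q1Q.
  by apply: le_trans (Gge _ _ xQ yQ); rewrite ler_wpM2r// mdist_ge0.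
(* nx x is the maximal special subcube around x, and q picks in each subcube a point
   of the class to which the whole piece is attached. *)
pose nx x := xget set0 [set Q' | [/\ maximal_in Q Q', Q' x, letter Q' x = l &
  has_code letter w Q' x]].
have nxP x : coded (l :: w) Q x ->
    [/\ maximal_in Q (nx x), nx x x, letter (nx x) x = l & coded w (nx x) x].
  move=> [Yx Qx [Q' HQ']]; rewrite /nx; case: xgetP => [P _ [mP Px lP wP]|/(_ Q')//].
  by split.
pose q Q' := xget x0 [set x | coded (l :: w) Q x /\ nx x = Q'].
have qP x : coded (l :: w) Q x -> coded (l :: w) Q (q (nx x)) /\ nx (q (nx x)) = nx x.
  by move=> xQ; rewrite /q; case: xgetP => [z _ //|/(_ x)[]].
have cubeN x : coded (l :: w) Q x -> cubes D (nx x).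
  by move=> /nxP[[S' _ _ _] _ _ _]; exact: Sp_cube.
have Gle x : coded (l :: w) Q x -> lam * enorm (G (nx x) x) <= 2 * lam * rdiam (nx x).
  move=> /nxP[[S' _ _ _] _ _ xw]; have [/(_ _ xw) le _] := GP _ S'.
  by rewrite -mulrA mulrCA ler_pM2l.
have [Yx0 Qx0 _] := x0Q.
exists (fun x => h (q (nx x)) - h x0 + lam *: G (nx x) x); split=> [x xQ|x y xQ yQ].
  have [mx nxx _ _] := nxP _ xQ; have [_ nQ _ _] := mx.
  have [[_ Qq _] _] := qP _ xQ.
  apply: le_trans (enormD _ _) _; rewrite (enormZ _ (ltW lam0)).
  have := h1 (q (nx x)) x0; have := mdist_le_rdiam cQ Qq Qx0.
  have := le_rdiam (cubeN _ xQ) cQ nQ; have := rdiam_gt0 (cubeN _ xQ).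
  have := Gle _ xQ; have := lam1; have := lam0.
  move: (rdiam (nx x)) => a l0 l1 e1 a0 aQ e2 e3.
  have la : lam * a <= a / 32 by rewrite mulrC ler_pM2l// -div1r.
  exact: attached_le e1 a0 aQ e2 e3 la.
have [mx nxx lx wx] := nxP _ xQ; have [my nyy ly wy] := nxP _ yQ.
have [Nxy|Nxy] := pselect (nx x = nx y).
  rewrite Nxy in mx nxx lx wx *.
  have -> : h (q (nx y)) - h x0 + lam *: G (nx y) x
      - (h (q (nx y)) - h x0 + lam *: G (nx y) y) = lam *: (G (nx y) x - G (nx y) y).
    by rewrite opprD addrACA subrr add0r scalerBr.
  have [S' _ _ _] := my; have [_ /(_ _ _ wx wy) ge] := GP _ S'.
  by rewrite (enormZ _ (ltW lam0)) exprS -mulrA ler_pM2l.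
have [qxQ qx] := qP _ xQ; have [qyQ qy] := qP _ yQ.
set p := q (nx x) in qxQ qx *; set p' := q (nx y) in qyQ qy *.
have [_ np lp _] := nxP _ qxQ; have [_ np' lp' _] := nxP _ qyQ.
rewrite qx in np lp; rewrite qy in np' lp'.
have [Yp _ _] := qxQ; have [Yp' _ _] := qyQ.
have lpp' := etrans lp (esym lp').
have [far1 far2 _] := same_letter_separated mx my Nxy np np' Yp Yp' lpp'.
have hpp' := chart_separated cQ hP mx my Nxy np np' Yp Yp' lpp'.
have d1 : tau * rdiam (nx x) <= M * mdist p p'.
  have := rdiam_le (cubeN _ xQ); rewrite -(ler_pM2l tau0) => /le_trans; apply.
  by rewrite mulrCA ler_pM2l// ltW.
have d2 : tau * rdiam (nx y) <= M * mdist p p'.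
  have := rdiam_le (cubeN _ yQ); rewrite -(ler_pM2l tau0) => /le_trans; apply.
  by rewrite mulrCA ler_pM2l// ltW.
have xp := mdist_le_rdiam (cubeN _ xQ) nxx np.
have yp := mdist_le_rdiam (cubeN _ yQ) nyy np'.
have dxy : tau * mdist x y <= 3 * M * mdist p p'.
  have t : mdist x y <= rdiam (nx x) + mdist p p' + rdiam (nx y).
    have := metric_triangle x p y; have := metric_triangle p p' y.
    rewrite (metric_sym p' y) => t1 t2; apply: le_trans t2 _.
    by rewrite -addrA lerD// (le_trans t1)// lerD.
  have t3 : tau * mdist p p' <= M * mdist p p'.
    rewrite ler_wpM2r ?mdist_ge0//; case/andP: tau_itv => _ /le_trans; apply.
    exact: ltW.
  rewrite -(ler_pM2l tau0) !mulrDr in t.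
  apply: le_trans t _; rewrite (_ : 3 * M * _ = M * mdist p p' + M * mdist p p'
    + M * mdist p p'); first by rewrite !lerD.
  by ring.
(* Both attached pieces have size at most M / tau times the distance of the points
   p and p', so the factor lam makes them negligible. *)
have lamd d : tau * d <= M * mdist p p' -> lam * d <= mdist p p' / 32.
  move=> le; rewrite /lam mulrAC ler_pdivrMr ?mulr_gt0//.
  by apply: le_trans le _; rewrite mulrA divfK// mulrC.
have Gx := Gle _ xQ; have Gy := Gle _ yQ.
have l1 := lamd _ d1; have l2 := lamd _ d2.
have l3 : lam * mdist x y <= 3 * mdist p p' / 32.
  rewrite /lam mulrAC ler_pdivrMr ?mulr_gt0//.
  by apply: le_trans dxy _; rewrite (_ : _ / 32 * _ = 3 * M * mdist p p')//; field.
have l4 : lam ^+ (size w).+2 * mdist x y <= lam * mdist x y.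
  by rewrite ler_wpM2r ?mdist_ge0.
set a := lam *: G (nx x) x; set b := lam *: G (nx y) y.
have na : enorm a <= 2 * (mdist p p' / 32).
  by rewrite (enormZ _ (ltW lam0)); apply: le_trans Gx _; rewrite -mulrA ler_pM2l.
have nb : enorm b <= 2 * (mdist p p' / 32).
  by rewrite (enormZ _ (ltW lam0)); apply: le_trans Gy _; rewrite -mulrA ler_pM2l.
have : enorm (h p - h p') <= enorm (h p - h x0 + a - (h p' - h x0 + b)) + enorm (b - a).
  rewrite -[X in enorm X <= _](_ : h p - h x0 + a - (h p' - h x0 + b) + (b - a) = _).
    exact: enormD.
  by rewrite !opprD !opprK; apply/rowP => i; rewrite !mxE; ring.
have := enormD b (- a); rewrite enormN; have := mdist_ge0 p p'.
move: (enorm (h p - h x0 + a - (h p' - h x0 + b))) l4 => e /= l4 e1 e2 e3.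
exact: separated_ge hpp' l3 l4 na nb e1 e2 e3.
Qed.

End Construction.
End SpecialCubes.

(** * A big set of points with a common code *)

Section Selection.
Context {R : realType} {T : metricType R} {k : nat} {E : set T}.
Variables (D : dyadic_system k E) (R0 : set T) (Sp : set (set T)).
Hypothesis cubeR0 : cubes D R0.
Hypothesis Sp_cube : forall Q, Sp Q -> cubes D Q.
Hypothesis Sp_sub : forall Q, Sp Q -> Q `<=` R0.
Hypothesis SpR0 : Sp R0.
Variables (mu : {outer_measure set T -> \bar R}) (m C1 b : R) (N : nat).
Hypothesis muR0 : mu R0 = m%:E.
Hypothesis m_gt0 : 0 < m.
Hypothesis mu_gt0 : forall Q, Sp Q -> (0 < mu Q)%E.
Hypothesis packing : (\esum_(Q in Sp) mu Q <= (C1 * m)%:E)%E.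
Variable layer : set T -> set T.
Hypothesis b_ge0 : 0 <= b.
Hypothesis layer_le : forall Q, Sp Q -> (mu (layer Q) <= b%:E * mu Q)%E.
Hypothesis bC1 : b * C1 <= 1 / 4.
Hypothesis N_gt0 : (0 < N)%N.
Hypothesis NC1 : 4 * C1 <= N%:R.

Let mu_ge0 := outer_measure_ge0 mu.

Let countable_Sp : countable Sp.
Proof.
apply: (esum_fin_countable mu_gt0); apply: le_lt_trans packing _.
by rewrite ltry.
Qed.

Lemma layers_le : (mu (\bigcup_(Q in Sp) layer Q) <= (m / 4)%:E)%E.
Proof.
apply: le_trans (outer_measure_le_esum mu layer countable_Sp) _.
apply: le_trans (le_esum layer_le) _.
apply: le_trans (le_esumZ _ b_ge0 mu_ge0) _.
apply: (@le_trans _ _ (b%:E * (C1 * m)%:E)%E).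
  by rewrite lee_wpmul2l ?lee_fin.
rewrite -EFinM lee_fin mulrA ler_pdivlMr//.
by have := ler_wpM2r (ltW m_gt0) bC1; lra.
Qed.

(** The families of special cubes of depths 0, ..., N - 1 are pairwise disjoint, and
    each of them covers all points of depth N. By subadditivity, N times the measure
    of these points is at most the packing sum. *)
Lemma deep_le :
  (mu (\bigcup_(Q in [set Q | descendant Sp N R0 Q]) Q) <= (m / 4)%:E)%E.
Proof.
set deep := \bigcup_(Q in _) Q.
have desc_Sp i : [set Q | descendant Sp i R0 Q] `<=` Sp.
  by move=> Q; exact: descendant_Sp SpR0.
have deep_i i : (i < N)%N ->
    (mu deep <= \esum_(Q in [set Q | descendant Sp i R0 Q]) mu Q)%E.
  move=> iN; apply: le_trans (outer_measure_le_esum mu id _); last first.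
    exact: sub_countable (subset_card_le (desc_Sp i)) countable_Sp.
  apply: le_outer_measure => x [Q /(descendant_prefix (ltnW iN))[P dP QP] Qx].
  by exists P => //; exact: QP.
have : (\esum_(i in `I_N) mu deep <= (C1 * m)%:E)%E.
  apply: le_trans (le_esum (fun i (iN : `I_N i) => deep_i i iN)) _.
  rewrite -esum_bigcupT//; last first.
    move=> i j _ _ [Q [di dj]]; apply: (descendant_uniq Sp_cube _ di dj).
    exact: desc_Sp di.
  by apply: le_trans packing; apply: subset_esum => Q [i _]; exact: desc_Sp.
rewrite esum_fset//.
rewrite -fsbig_ord.
have : mu deep \is a fin_num.
  rewrite ge0_fin_numE//; apply: le_lt_trans (deep_i _ N_gt0) _.
  apply: le_lt_trans (subset_esum _ (desc_Sp 0%N)) _.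
  by apply: le_lt_trans packing _; rewrite ltry.
move=> /fineK <-; move: (fine _) => d.
rewrite sumEFin !lee_fin sumr_const card_ord => dN.
rewrite -[_ *+ _]mulr_natl in dN.
have N0 : 0 < N%:R :> R by rewrite ltr0n.
rewrite -(ler_pM2l N0); apply: le_trans dN _.
by have := ler_wpM2r (ltW m_gt0) NC1; lra.
Qed.

(** Once the boundary layers and the deep points are removed, half of the measure is
    left, and it is shared by the finitely many codes of length at most N. *)
Lemma exists_common_code (L : finType) (letter : set T -> T -> L) :
  exists w, (size w <= N)%N /\ ((m / (4 * #|{bseq N of L}|%:R))%:E <=
    mu [set x | (R0 `\` \bigcup_(Q in Sp) layer Q) x /\
                has_code Sp letter w R0 x])%E.
Proof.
pose X w := [set x | (R0 `\` \bigcup_(Q in Sp) layer Q) x /\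
                     has_code Sp letter w R0 x].
set c := m / _.
apply: contrapT => /forallNP small.
pose W := index_enum {bseq N of L}.
have cover : R0 `<=` (\bigcup_(Q in Sp) layer Q) `|`
    (\bigcup_(Q in [set Q | descendant Sp N R0 Q]) Q `|`
     \bigcup_(w in [set` W]) X w).
  move=> x R0x; have [lx|nlx] := pselect ((\bigcup_(Q in Sp) layer Q) x).
    by left.
  right; have := has_code_or_descendant cubeR0 Sp_cube Sp_sub letter N SpR0 R0x.
  move=> [[w wN wx]|[Q dQ Qx]]; last by left; exists Q.
  by right; exists (Bseq (ltnW wN)); [rewrite /= mem_index_enum|split].
have : (mu R0 <= (m / 4)%:E + ((m / 4)%:E + (#|{bseq N of L}|%:R * c)%:E))%E.
  apply: le_trans (le_outer_measure mu _ _ cover) _.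
  apply: le_trans (outer_measureU2 mu _ _) _; apply: leeD layers_le _.
  apply: le_trans (outer_measureU2 mu _ _) _; apply: leeD deep_le _.
  apply: le_trans (outer_measure_le_sum mu _ _) _.
  apply: (@le_trans _ _ (\sum_(w <- W) c%:E)%E).
    apply: lee_sum => w _; rewrite leNgt; apply/negP => /ltW wc.
    by apply: (small w); split=> //; exact: size_bseq.
  by rewrite sumEFin lee_fin sumr_const mulr_natl.
rewrite muR0 -!EFinD lee_fin leNgt => /negP; apply.
have [W0|W0] := eqVneq (#|{bseq N of L}|%:R : R) 0.
  by rewrite W0 mul0r addr0; have := m_gt0; lra.
have -> : #|{bseq N of L}|%:R * c = m / 4 by rewrite /c; field.
by have := m_gt0; lra.
Qed.

End Selection.

(** * Special cubes of a corona decomposition *)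

Section CoronaSpecialCubes.
Context {R : realType} {T : metricType R} {k : nat} {E : set T}.
Variables (D : dyadic_system k E) (C : R) (G B : set (set T)) (F : set (set (set T))).
Hypothesis corona : coronization D C G B F.
Hypothesis C_gt0 : 0 < C.
Variable R0 : set T.
Hypothesis cubeR0 : cubes D R0.

Local Notation rho := (dy_rho D).
Local Notation M := (dy_const D).

Let rho0 : 0 < rho := rho_gt0 D.
Let M0 : 0 < M := dy_const_gt0 D.

Definition special : set (set T) := [set Q | [/\ cubes D Q, Q `<=` R0 &
  [\/ Q = R0, B Q | exists2 S, F S & Q = tree_top S]]].

Lemma tree_topP S : F S -> is_tree_top S (tree_top S).
Proof.
have [_ _ _ coh _] := corona => /coh[[Q [topQ _]] _ _].
by rewrite /tree_top; case: xgetP => [//|/(_ Q)].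
Qed.

Lemma cube_cases Q : cubes D Q -> B Q \/ exists2 S, F S & S Q.
Proof.
have [[-> _] _ [-> _] _ _] := corona.
by case=> [[S FS SQ]|BQ]; [right; exists S|left].
Qed.

Lemma tree_cube S Q : F S -> S Q -> cubes D Q.
Proof. by have [[-> _] _ [-> _] _ _] := corona => FS SQ; left; exists S. Qed.

Lemma tree_not_bad S Q : F S -> S Q -> ~ B Q.
Proof.
have [[_ GB] _ [GE _] _ _] := corona => FS SQ BQ.
by have : set0 Q by rewrite -GB GE; split=> //; exists S.
Qed.

Lemma tree_uniq S S' Q : F S -> F S' -> S Q -> S' Q -> S = S'.
Proof.
by have [_ _ [_ tF] _ _] := corona => FS FS' SQ S'Q; apply: tF => //; exists Q.
Qed.

Lemma tree_convex S Q P : F S -> S Q -> cubes D P -> Q `<=` P ->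
  P `<=` tree_top S -> S P.
Proof.
have [_ _ _ coh _] := corona => FS; have [_ conv _] := coh _ FS.
by move=> SQ cP QP PS; exact: conv SQ cP QP PS.
Qed.

Let A := 2 * (M ^+ 2 / rho).

(** Below a bad cube there is a special cube of comparable size around each point:
    a cube of at most half its diameter either is bad or belongs to a tree, whose
    top cannot contain the bad cube. A cube which lies below a cube Q of a tree and is not
    separated from it by a special cube belongs to the tree of Q. *)
Lemma special_cases :
  (forall S, F S -> exists h : T -> 'rV[R]_k,
    (forall x y, enorm (h x - h y) <= mdist x y) /\
    forall P x y, S P -> E x -> P y -> mdist x y <= rdiam P ->
      rdiam P <= A * mdist x y -> mdist x y <= 4 * enorm (h x - h y)) ->
  forall Q, special Q -> shrinking special A Q \/ charted D special A Q.
Proof.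
move=> charts Q [cQ QR _]; have dQ := rdiam_gt0 cQ.
have A0 : 0 < A by rewrite mulr_gt0 ?divr_gt0 ?exprn_gt0.
have [BQ|[S FS SQ]] := cube_cases cQ; [left|right].
  move=> x Qx; pose d := rdiam Q / A.
  have d0 : 0 < d by rewrite divr_gt0.
  have dA : M ^+ 2 / rho * d = rdiam Q / 2.
    rewrite /d /A; field; rewrite !gt_eqF//.
  have A1 : 1 <= A.
    have /andP[_ /ltW r1] := dy_rho_itv D.
    rewrite /A mulrA ler_pdivlMr// mul1r (le_trans r1)//.
    have := exprn_ege1 2 (ltW (dy_const_gt1 D)); lra.
  have dQle : d <= rdiam Q by rewrite ler_pdivrMr// ler_peMr// ltW.
  have [P [cP Px PQ dP]] := intermediate_cube cQ Qx d0 dQle; rewrite dA => Pd.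
  have QA : rdiam Q <= A * rdiam P by rewrite -ler_pdivrMl// mulrC.
  have Pneq : P <> Q by move=> PQE; rewrite PQE in Pd; lra.
  have [BP|[S FS SP]] := cube_cases cP.
    exists P; split=> //; split=> //; first exact: subset_trans QR.
    by apply: Or32.
  have [topS Stop] := tree_topP FS; have ctop := tree_cube FS topS.
  have Ptop := Stop _ SP; have xtop := Ptop _ Px.
  have topQ : tree_top S `<=` Q.
    have [//|Qtop] := cube_nested ctop cQ xtop Qx.
    by case: (tree_not_bad FS (tree_convex FS SP cQ PQ Qtop) BQ).
  exists (tree_top S); split=> //.
  - split=> //; first exact: subset_trans QR.
    by apply: Or33; exists S.
  - by move=> topE; case: (tree_not_bad FS topS); rewrite topE.
  - by apply: le_trans QA _; rewrite ler_pM2l//; exact: le_rdiam cP ctop Ptop.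
have [h [h1 hS]] := charts S FS; exists h; split=> // P x y cP PQ Pout Ex Py.
apply: (hS P) => //.
have [BP|[S' FS' S'P]] := cube_cases cP.
  have [PE|Pneq] := pselect (P = Q); first by rewrite PE.
  exfalso; apply: (Pout P) => //; split=> //; first exact: subset_trans QR.
  by apply: Or32.
have [topS' S'top] := tree_topP FS'; have ctop := tree_cube FS' topS'.
have Ptop := S'top _ S'P.
suff S'Q : S' Q by rewrite (tree_uniq FS FS' SQ S'Q).
have [topQ|Qtop] := cube_nested ctop cQ (Ptop _ Py) (PQ _ Py); last first.
  exact: tree_convex FS' S'P cQ PQ Qtop.
have [<-//|topneq] := pselect (tree_top S' = Q).
exfalso; apply: (Pout (tree_top S')) => //; split=> //.
  exact: subset_trans QR.
by apply: Or33; exists S'.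
Qed.

(** Distinct trees have distinct tops, so the sum over the tops is the sum over the
    trees. *)
Lemma special_packing :
  (\esum_(Q in special) hausdorff k Q <= (1 + 2 * C)%:E * hausdorff k R0)%E.
Proof.
have [_ packB _ _ packT] := corona.
have mu0 := @hausdorff_ge0 R T k.
pose Bs := [set Q | B Q /\ Q `<=` R0].
pose Fs := [set S | F S /\ tree_top S `<=` R0].
have sub : special `<=` [set R0] `|` (Bs `|` tree_top @` Fs).
  move=> Q [cQ QR [->|BQ|[S FS QE]]]; [by left|by right; left|right; right].
  by exists S => //; split=> //; rewrite -QE.
apply: le_trans (subset_esum _ sub) _.
apply: le_trans (le_esumU _ _ mu0) _.
rewrite esum_set1//.
have := le_esumU Bs (tree_top @` Fs) mu0; rewrite esum_image; last first.
  move=> S S' /set_mem[FS _] /set_mem[FS' _] SS'.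
  apply: (tree_uniq FS FS' (tree_topP FS).1).
  by rewrite SS'; exact: (tree_topP FS').1.
move=> le2; have := leeD (packB _ cubeR0) (packT _ cubeR0).
move=> /(le_trans le2) le3; apply: le_trans (leeD (lexx _) le3) _.
rewrite -ge0_muleDl ?lee_fin ?(ltW C_gt0)//.
rewrite -[X in (X + _ <= _)%E]mul1e -ge0_muleDl//.
  by rewrite -!EFinD (_ : C + C = 2 * C)//; ring.
by rewrite -EFinD lee_fin addr_ge0// ltW.
Qed.

End CoronaSpecialCubes.

(** * Big pieces from charts and colourings *)

Section BigPieces.
Context {R : realType} {T : metricType R} {k : nat} {E : set T}.
Variable D : dyadic_system k.+1 E.

Local Notation rho := (dy_rho D).
Local Notation M := (dy_const D).

Let rho01 : 0 < rho < 1 := dy_rho_itv D.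
Let rho0 : 0 < rho := rho_gt0 D.
Let M0 : 0 < M := dy_const_gt0 D.
Let M1 : 1 < M := dy_const_gt1 D.

Lemma exists_cube_scale x (r : R) : E x -> 0 < r -> (r%:E < diam E)%E ->
  exists Q, [/\ cubes D Q, Q x, rdiam Q <= r &
    ((M^-1 * (rho / M * r) ^+ k.+1)%:E <= hausdorff k.+1 Q)%E /\
    (hausdorff k.+1 Q < +oo)%E].
Proof.
move=> Ex r0 rE; have rM0 : 0 < r / M by rewrite divr_gt0.
have [i /andP[i1 i2]] := exprz_bracket rho01 rM0.
have gi : dy_gen D (i + 1).
  have [[_ ->]//|[J0 [_ EJ ->]]] := dy_genP D.
  apply/ltW/(exprz_le_inv rho01); apply: lt_trans i1 _.
  apply: (@lt_trans _ _ r); first by rewrite ltr_pdivrMr// ltr_pMr.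
  by rewrite -lte_fin; exact: lt_trans EJ.
have [Q Qi Qx] := exists_cube gi Ex.
have [/andP[_ Qr] _] := rdiamP gi Qi.
have /andP[mu1 mu2] := dy_measure gi Qi.
exists Q; split=> //; first by exists (i + 1).
  by apply: le_trans Qr _; rewrite mulrC -ler_pdivlMr// ltW.
split; last by apply: le_lt_trans mu2 _; rewrite ltry.
apply: le_trans mu1; rewrite lee_fin ler_pM2l ?invr_gt0// -exprz_exp -exprnP.
rewrite ler_pXn2r ?nnegrE ?exprz_ge0 ?(ltW rho0)//; last first.
  by rewrite !mulr_ge0 ?invr_ge0// ltW.
by rewrite expfzDr ?gt_eqF// expr1z mulrAC -mulrA mulrC ler_pM2r// mulrC.
Qed.

Lemma cube_measure_gt0 Q : cubes D Q -> (0 < hausdorff k.+1 Q)%E.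
Proof.
move=> [j gj Qj]; have /andP[+ _] := dy_measure gj Qj; apply: lt_le_trans.
by rewrite lte_fin mulr_gt0 ?invr_gt0// exprz_gt0.
Qed.

(** The width is chosen after the packing constant C1, hence after the accuracy eta of
    the approximating graphs on which C1 depends. *)
Lemma exists_layer_width (C1 : R) : 0 < C1 ->
  exists2 tau, 0 < tau <= 1 & M * tau `^ M^-1 * C1 <= 1 / 4.
Proof.
move=> C10; pose u := (1 + 4 * M * C1)^-1.
have v0 : 0 < 4 * M * C1 by rewrite !mulr_gt0.
have u0 : 0 < u by rewrite invr_gt0 ltr_wpDl.
have u1 : u <= 1 by rewrite invf_le1 ?ltr_wpDl// lerDl ltW.
exists (u `^ M).
  rewrite powR_gt0//= -[leRHS](powRr0 u); apply: ger_powR; last exact: ltW.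
  by rewrite u0.
rewrite -powRrM divff ?gt_eqF// powRr1 ?(ltW u0)//.
rewrite mulrAC /u ler_pdivrMr ?ltr_wpDl//; lra.
Qed.

(** The parametrization f inverts an expanding map g on the class of points with a
    common code; the factor 1 / 2 brings the image of g into the ball of radius r. *)
Theorem corona_big_pieces (C : R) (G B : set (set T)) (F : set (set (set T))) :
  (forall Lam : R, 0 < Lam -> exists K : finType, forall s : R, 0 < s ->
     exists c : T -> K, forall x y, c x = c y ->
       mdist x y <= s \/ Lam * s <= mdist x y) ->
  0 < C -> coronization D C G B F ->
  (forall S, F S -> exists h : T -> 'rV[R]_k.+1,
    (forall x y, enorm (h x - h y) <= mdist x y) /\
    forall P x y, S P -> E x -> P y -> mdist x y <= rdiam P ->
      rdiam P <= 2 * (M ^+ 2 / rho) * mdist x y ->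
      mdist x y <= 4 * enorm (h x - h y)) ->
  exists c L : R, [/\ 0 < c, 0 < L &
    forall x, E x -> forall r : R, 0 < r -> (r%:E < diam E)%E ->
    exists (A : set 'rV[R]_k.+1) (f : 'rV[R]_k.+1 -> T),
      [/\ forall a, A a -> enorm a <= r,
          forall a b, A a -> A b -> mdist (f a) (f b) <= L * enorm (a - b) &
          ((c * r ^+ k.+1)%:E <=
             hausdorff k.+1 (E `&` cball x r `&` (f @` A)))%E]].
Proof.
move=> colour C0 corona charts.
pose A := 2 * (M ^+ 2 / rho).
have A0 : 0 < A by rewrite mulr_gt0 ?divr_gt0 ?exprn_gt0.
have A_ge : M ^+ 2 / rho <= A by rewrite ler_peMl ?ler1n// ltW// divr_gt0 ?exprn_gt0.
pose Lam := 2 * (A * M).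
have AM0 : 0 < A * M by exact: mulr_gt0.
have Lam0 : 0 < Lam by exact: mulr_gt0.
have Lam_gt : A * M < Lam by rewrite /Lam ltr_pMl ?ltr1n.
pose C1 := 1 + 2 * C.
have C10 : 0 < C1 by rewrite ltr_wpDr// mulr_ge0// ltW.
have [tau tau_itv tauC1] := exists_layer_width C10.
have tau0 : 0 < tau by case/andP: tau_itv.
have [N1 rhoN1] : exists N : nat, rho ^+ N < tau / Lam.
  by apply: (exprn_lt rho01); rewrite divr_gt0.
have rhoN : Lam * rho ^+ N1 <= tau by rewrite mulrC -ler_pdivlMr// ltW.
pose N := (Num.truncn (4 * C1)).+1.
have NC1 : 4 * C1 <= N%:R by rewrite ltW// truncnS_gt.
have [K KP] := colour (Lam / tau) (divr_gt0 Lam0 tau0).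
have [cc ccP] : {cc : int -> T -> K & forall j x y, cc j x = cc j y ->
    mdist x y <= tau * rho ^ j \/ Lam * rho ^ j <= mdist x y}.
  apply: (@choice _ _ (fun j c => forall x y, c x = c y ->
    mdist x y <= tau * rho ^ j \/ Lam * rho ^ j <= mdist x y)) => j.
  have [c cP] := KP (tau * rho ^ j) (mulr_gt0 tau0 (exprz_gt0 _ rho0)).
  by exists c => x y /cP; rewrite mulrA divfK ?gt_eqF.
have [cz czP] := int_colouring N1.
pose W : R := #|{bseq N of 'I_N1.+1 * K}|%:R.
have W0 : 0 < W.
  by rewrite ltr0n; apply/card_gt0P; exists [bseq].
pose lam := tau / (32 * M).
have lam0 : 0 < lam by rewrite divr_gt0 ?mulr_gt0.
have lam1 : lam <= 1.
  rewrite ler_pdivrMr ?mulr_gt0// mul1r; case/andP: tau_itv => _ /le_trans; apply.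
  by have := M1; lra.
(* The factor 4 * W is the loss in the choice of the code, the rest bounds the
   measure of a cube of diameter about r from below. *)
exists (M^-1 * (rho / M) ^+ k.+1 / (4 * W)), (2 / lam ^+ N.+1); split.
- by rewrite divr_gt0 ?mulr_gt0 ?exprn_gt0 ?invr_gt0 ?divr_gt0.
- by rewrite divr_gt0 ?exprn_gt0.
move=> x Ex r r0 rE.
have [R0 [cR0 R0x R0r [mu_ge mu_fin]]] := exists_cube_scale Ex r0 rE.
have [m muR0] : exists m, hausdorff k.+1 R0 = m%:E.
  by exists (fine (hausdorff k.+1 R0)); rewrite fineK// ge0_fin_numE ?hausdorff_ge0.
have m0 : 0 < m by rewrite -lte_fin -muR0 cube_measure_gt0.
pose Sp := special D B F R0.
have Sp_cube Q : Sp Q -> cubes D Q by case.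
have Sp_sub Q : Sp Q -> Q `<=` R0 by case.
have SpR0 : Sp R0 by split=> //; apply: Or31.
have Sp_cases Q : Sp Q -> shrinking Sp A Q \/ charted D Sp A Q.
  exact: (special_cases corona charts).
pose layer Q := [set x | Q x /\ (setdist x (E `\` Q) <= (tau * rho ^ level D Q)%:E)%E].
have packing : (\esum_(Q in Sp) hausdorff k.+1 Q <= (C1 * m)%:E)%E.
  rewrite EFinM -muR0.
  have := special_packing corona C0 cR0.
  rewrite -/Sp -/C1. exact.
have layer_le Q : Sp Q ->
    (hausdorff k.+1 (layer Q) <= (M * tau `^ M^-1)%:E * hausdorff k.+1 Q)%E.
  by move=> /Sp_cube/levelP[gl Ql]; exact: dy_boundary gl Ql tau0.
have b0 : 0 <= M * tau `^ M^-1 by rewrite mulr_ge0 ?powR_ge0// ltW.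
pose ltr := letter D cz cc.
have [w [wN wm]] := exists_common_code cR0 Sp_cube Sp_sub SpR0 muR0 m0
  (fun Q SQ => cube_measure_gt0 (Sp_cube Q SQ)) packing b0 layer_le tauC1
  (ltn0Sn _) NC1 ltr.
pose Y := R0 `\` \bigcup_(Q in Sp) layer Q.
have Y_inner z Q y : Y z -> Sp Q -> Q z -> E y ->
    mdist z y <= tau * rho ^ level D Q -> Q y.
  move=> [_ nlz] SQ Qz Ey zy; apply: contrapT => nQy; apply: nlz.
  exists Q => //; split=> //; apply: (@le_trans _ _ (mdist z y)%:E).
    by apply: ereal_inf_lbound; exists y.
  by rewrite lee_fin.
have [g [g_le g_ge]] := coded_expanding Sp_cube A_ge Sp_cases tau_itv Lam_gt
  rhoN czP ccP Y_inner w SpR0.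
rewrite -/lam in g_ge.
pose Z := coded D Sp cz cc Y w R0.
have ZE : Z = [set x | Y x /\ has_code Sp ltr w R0 x].
  apply/seteqP; split=> [y [Yy _ cy]|y [Yy cy]]; first by split.
  by split=> //; case: Yy.
have lamN : lam ^+ N.+1 <= lam ^+ (size w).+1.
  rewrite -(subnKC (_ : (size w).+1 <= N.+1)%N) ?ltnS// exprD ler_piMr//.
    by rewrite exprn_ge0// ltW.
  by rewrite exprn_ile1// ltW.
have gZ y z : Z y -> Z z -> lam ^+ N.+1 * mdist y z <= enorm (g y - g z).
  by move=> Zy Zz; apply: le_trans (g_ge _ _ Zy Zz); rewrite ler_wpM2r// mdist_ge0.
have g_inj y z : Z y -> Z z -> g y = g z -> y = z.
  move=> Zy Zz gyz; apply: mdist_positivity; apply/eqP; rewrite eq_le mdist_ge0 andbT.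
  have := gZ _ _ Zy Zz; rewrite gyz subrr enorm0.
  by rewrite pmulr_rle0// exprn_gt0.
pose f a := xget x [set y | Z y /\ 2^-1 *: g y = a].
have fg y : Z y -> f (2^-1 *: g y) = y.
  move=> Zy; rewrite /f; case: xgetP => [z _ [Zz]|/(_ y)[]//].
  move=> /scalerI gyz; apply: g_inj => //; apply: gyz.
  by rewrite invr_neq0.
exists ((fun y => 2^-1 *: g y) @` Z), f; split.
- move=> _ [y Zy <-]; rewrite enormZ ?invr_ge0//.
  have := g_le _ Zy; rewrite ler_pdivrMl//; lra.
- move=> _ _ [y Zy <-] [z Zz <-]; rewrite !fg// -scalerBr enormZ ?invr_ge0//.
  rewrite mulrACA divff// mul1r ler_pdivlMl ?exprn_gt0//.
  exact: gZ.
apply: (@le_trans _ _ (m / (4 * W))%:E).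
  rewrite lee_fin mulrAC ler_pM2r ?invr_gt0 ?mulr_gt0//.
  by move: mu_ge; rewrite muR0 lee_fin exprMn mulrA.
apply: le_trans wm _; rewrite -ZE; apply: le_hausdorff => y Zy.
have [_ R0y _] := Zy; split; last by exists (2^-1 *: g y); [exists y|exact: fg].
split; first exact: cube_sub cR0 _ R0y.
exact: le_trans (mdist_le_rdiam cR0 R0x R0y) R0r.
Qed.

End BigPieces.

(** * Corona decompositions by intrinsic Lipschitz graphs *)

(** A cube of the tree through y whose size is comparable to d(x, y) puts both points
    within a small fraction of d(x, y) from the graph. *)
Lemma tree_chart (R : realType) (n k : nat) (E : set (heis R n))
    (D : dyadic_system k E) (A eta : R) (S : set (set (heis R n)))
    (Gamma : set (heis R n)) :
  0 < eta < 1 -> 24 * eta * A <= 1 -> (forall Q, S Q -> cubes D Q) ->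
  ilip_graph k eta Gamma ->
  (forall Q, S Q -> forall x, E x -> (setdist x Q <= diam Q)%E ->
     (setdist x Gamma <= eta%:E * diam Q)%E) ->
  exists h : heis R n -> 'rV[R]_k,
    (forall x y, enorm (h x - h y) <= mdist x y) /\
    forall Q x y, S Q -> E x -> Q y -> mdist x y <= rdiam Q ->
      rdiam Q <= A * mdist x y -> mdist x y <= 4 * enorm (h x - h y).
Proof.
move=> eta01 etaA S_cube graphG near.
have [h [h1 hP]] := ilip_graph_projection eta01 graphG.
exists h; split=> // Q x y SQ Ex Qy xyQ QA.
have /andP[eta0 _] := eta01.
have cQ := S_cube Q SQ; have dQ := rdiam_gt0 cQ.
have Ey := cube_sub cQ Qy.
have near_lt z : E z -> mdist z y <= rdiam Q ->
    (setdist z Gamma < (2 * (eta * rdiam Q))%:E)%E.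
  move=> Ez zy; apply: (@le_lt_trans _ _ (eta%:E * diam Q)%E).
    apply: near => //; rewrite (diamE cQ); apply: (@le_trans _ _ (mdist z y)%:E).
      by apply: ereal_inf_lbound; exists y.
    by rewrite lee_fin.
  by rewrite (diamE cQ) -EFinM lte_fin ltr_pMl ?ltr1n// mulr_gt0.
have := hP x y _ (near_lt _ Ex xyQ) (near_lt _ Ey _).
rewrite mdistxx => /(_ (ltW dQ)).
have : 24 * (eta * rdiam Q) <= mdist x y.
  apply: (@le_trans _ _ (24 * eta * A * mdist x y)).
    by rewrite -!mulrA !ler_pM2l.
  by rewrite ler_piMl// mdist_ge0.
move: (enorm _) (mdist x y) (eta * rdiam Q) => e d a; lra.
Qed.

Theorem corollary1p8 (R : realType) (n k : nat) (hk : (1 <= k <= n)%N)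
    (E : set (heis R n)) (D : dyadic_system k E) :
  regular k E -> ILG_C D -> BPLI k E.
Proof.
move=> _ ILG; case: k hk D ILG => // k _ D ILG.
pose A := 2 * (dy_const D ^+ 2 / dy_rho D).
have A0 : 0 < A.
  by rewrite mulr_gt0 ?divr_gt0 ?exprn_gt0 ?dy_const_gt0 ?rho_gt0.
(* Any eta in (0, 1) with 24 * eta * A <= 1 would do. *)
pose eta := (1 + 24 * A)^-1.
have A24 : 0 < 24 * A by exact: mulr_gt0.
have v0 : 0 < 1 + 24 * A by rewrite ltr_wpDr// ltW.
have eta01 : 0 < eta < 1.
  by rewrite invr_gt0 v0 invf_lt1// ltrDl.
have etaA : 24 * eta * A <= 1.
  by rewrite mulrAC ler_pdivrMr// mul1r lerDr.
have /andP[eta0 _] := eta01.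
have [C [C0 [G [B [F [corona near]]]]]] := ILG eta eta0.
apply: (corona_big_pieces (fun Lam => @heis_colouring R n Lam) C0 corona) => S FS.
have [Gamma [graphG nearG]] := near S FS.
by apply: (tree_chart eta01 etaA _ graphG nearG) => Q SQ; exact: (tree_cube corona FS SQ).
Qed.
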